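(* Let $\Gamma$ be a metric graph, $D$ a divisor on $\Gamma$, and $M\subset\mathrm{Rat}(D)$ an admissible semimodule. Then $M$ determines its underlying slope structure uniquely: if $\mathfrak S$ and $\mathfrak S'$ are slope structures on $\Gamma$, of widths $r$ and $r'$ respectively, such that $M$ is admissible of rank $r$ with underlying slope structure $\mathfrak S$ and admissible of rank $r'$ with underlying slope structure $\mathfrak S'$, then $\mathfrak S=\mathfrak S'$.
   Context: Metric graphs. A metric graph $\Gamma$ is the metric realization of a pair $(G,\ell)$, where $G=(V,E)$ is a finite connected graph with at least one edge and $\ell\colon E\to\mathbb R_{>0}$: each edge $e$ is replaced by a closed interval of length $\ell(e)$, glued according to $G$, with the path metric. $G$ (with $\ell$) is called a model of $\Gamma$; a model is simple if it has no loops and no parallel edges. $\mathrm T_x(\Gamma)$ is the finite set of outgoing unit tangent vectors at $x$, and $d_x=|\mathrm T_x(\Gamma)|$. $\mathrm{Rat}(\Gamma)$ is the set of continuous piecewise affine functions $f\colon\Gamma\to\mathbb R$ with integral slopes; $\mathrm{slope}_\nu(f)$ is the outgoing slope of $f$ along $\nu$. A divisor $D$ is a finite formal integer combination of points of $\Gamma$, $D(x)$ is its coefficient at $x$, $D\ge 0$ (effective) means all coefficients are $\geq 0$. $\mathrm{div}(f)=\sum_x \mathrm{ord}_x(f)(x)$ with $\mathrm{ord}_x(f)=-\sum_{\nu\in \mathrm T_x(\Gamma)}\mathrm{slope}_\nu(f)$. $\mathrm{Rat}(D)=\{f\in\mathrm{Rat}(\Gamma): D+\mathrm{div}(f)\ge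 0\}$. Hypercube rank functions. Put $[r]=\{0,\dots,r\}$ for an integer $r\ge 0$. The hypercube $[r]^\delta$ ($\delta\geq 1$) carries the coordinatewise order $\preceq$ and coordinatewise max $\vee$ and min $\wedge$; $\underline e_i$ is the $i$-th unit vector. A rank function is a map $\rho\colon[r]^\delta\to\mathbb Z$ such that: (1) $\rho(t\,\underline e_i)=r-t$ for all $i$ and $t\in[r]$; (2) $\underline a\preceq\underline b$ implies $\rho(\underline b)\le\rho(\underline a)$; (3) $\rho(\underline a)+\rho(\underline b)\le\rho(\underline a\vee\underline b)+\rho(\underline a\wedge\underline b)$; (4) $\rho$ takes values in $\{-1,0,\dots,r\}$. A jump of $\rho$ is a point $\underline a$ with $\rho(\underline a)\ge 0$ and $\rho(\underline a+\underline e_i)=\rho(\underline a)-1$ for every $i$ with $\underline a+\underline e_i\in[r]^\delta$. The standard rank function is $\rho(\underline a)=\max\{-1,r-a_1-\dots-a_\delta\}$. Slope structures. A slope structure $\mathfrak S$ of width $r$ on $\Gamma$ is the data, on some simple graph model $G=(V,E)$ of $\Gamma$, of: for every oriented edge $uv$, a set $S^{uv}$ of integers $s_0^{uv}<\dots<s_r^{uv}$ with $s_i^{uv}+s_{r-i}^{vu}=0$; for every $v\in V$, a rank function $\rho_v$ on $[r]^{d_v}$, whose coordinates are indexed by the oriented edges with tail $v$ (equivalently by $\mathrm T_v(\Gamma)$). It is extended to all of $\Gamma$: for $\nu\in \mathrm T_x(\Gamma)$, $S^\nu=\{s_0^\nu<\dots<s_r^\nu\}$ is $S^{uv}$ for the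 oriented edge $uv$ parallel to $\nu$; for $x\in\Gamma\setminus V$, $\rho_x$ is the standard rank function on $[r]^2$. Two slope structures on $\Gamma$ (possibly given on different models) are equal if they have the same width, the same sets $S^\nu$ and the same rank functions $\rho_x$ for all $x\in\Gamma$, $\nu\in\mathrm T_x(\Gamma)$. For $\underline a=(a_\nu)_\nu\in[r]^{\mathrm T_x(\Gamma)}$ put $s_{\underline a}=(s^\nu_{a_\nu})_\nu$, and let $S^x=\{s_{\underline a}:\underline a\text{ a jump of }\rho_x\}$. A function $f\in\mathrm{Rat}(\Gamma)$ is compatible with $\mathfrak S$ if for every $x\in\Gamma$, $\mathrm{slope}_\nu(f)\in S^\nu$ for all $\nu\in\mathrm T_x(\Gamma)$, and $\partial_x(f):=(\mathrm{slope}_\nu(f))_{\nu\in \mathrm T_x(\Gamma)}\in S^x$. If $\partial_x(f)=s_{\underline a}$, write $\rho_x(\partial_x(f)):=\rho_x(\underline a)$. $\mathrm{Rat}(D,\mathfrak S)$ is the set of $f\in\mathrm{Rat}(D)$ compatible with $\mathfrak S$. Admissible semimodules. A semimodule is a subset of $\mathrm{Rat}(\Gamma)$ stable under $(f,g)\mapsto\min(f,g)$ and $f\mapsto f+c$, $c\in\mathbb R$. A semimodule $M\subseteq\mathrm{Rat}(D)$ is admissible of rank $r$, with underlying slope structure $\mathfrak S$, if it is closed for the topology of $\|\cdot\|_\infty$, $\mathfrak S$ is a slope structure of width $r$ with $M\subseteq\mathrm{Rat}(D,\mathfrak S)$, and for every effective divisor $E$ of degree $r$ there is $f\in M$ with $\rho_x(\partial_x(f))\ge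 E(x)$ for all $x\in\Gamma$ and $D+\mathrm{div}(f)-E\ge 0$. It is admissible if it is admissible of rank $r$ with some underlying slope structure, for some $r\geq 0$. *)

(* Defs.v *)
From HB Require Import structures.
From mathcomp Require Import all_boot all_order all_algebra.
From mathcomp Require Import all_classical all_reals all_analysis.
From mathcomp Require Import freeg.

Set Implicit Arguments.
Unset Strict Implicit.
Unset Printing Implicit Defensive.

Import Order.TTheory GRing.Theory Num.Theory.
Import numFieldNormedType.Exports.

Local Open Scope classical_set_scope.
Local Open Scope ring_scope.

(* Loops and parallel edges are allowed. The orientation given by [src] and
   [tgt] only serves to parametrize the edges. *)
Record wgraph (R : realType) := WGraph {
  vert : finType;
  edge : finType;
  src : edge -> vert;
  tgt : edge -> vert;
  len : edge -> R;
  len_gt0 : forall e, 0 < len e;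
  edge_gt0 : (0 < #|edge|)%N;
  graph_connected : forall u v : vert,
    connect (fun a b => [exists e, ((src e == a) && (tgt e == b))
                                || ((src e == b) && (tgt e == a))]) u v
}.

Definition simple_graph (R : realType) (G : wgraph R) : Prop :=
  (forall e : edge G, src e != tgt e) /\
  (forall e e' : edge G,
     [set src e; tgt e]%SET = [set src e'; tgt e']%SET -> e = e').

(* The oriented edge (e, true) runs from [src e] to [tgt e], and (e, false) is
   its reverse. *)
Definition oedge (R : realType) (G : wgraph R) : finType := (edge G * bool)%type.
Definition orev (R : realType) (G : wgraph R) (o : oedge G) : oedge G :=
  (o.1, ~~ o.2).

(* [chain_to p x y L]: a concatenation of segments, each inside one closed
   edge, leads from x to y and has total length L. *)
Inductive chain_to (R : realType) (T : Type) (G : wgraph R)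
    (p : edge G -> R -> T) (x : T) : T -> R -> Prop :=
| chain_nil : chain_to p x x 0
| chain_step e s t L :
    0 <= s <= len e -> 0 <= t <= len e ->
    chain_to p x (p e s) L -> chain_to p x (p e t) (L + `|s - t|).

(* [realization Gam G] identifies Gam with the metric realization of G: as a
   set it is the closed intervals [0, len e] glued along their end points, and
   its distance is the path metric. The values of [ept e] outside [0, len e]
   are irrelevant. *)
Record realization (R : realType) (Gam : metricType R) (G : wgraph R) :=
  Realization {
  vpt : vert G -> Gam;
  ept : edge G -> R -> Gam;
  ept_src : forall e, ept e 0 = vpt (src e);
  ept_tgt : forall e, ept e (len e) = vpt (tgt e);
  vpt_inj : injective vpt;
  ept_inj : forall e e' t t', 0 < t < len e -> 0 < t' < len e' ->
    ept e t = ept e' t' -> e = e' /\ t = t';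
  ept_vpt : forall e t v, 0 < t < len e -> ept e t <> vpt v;
  realization_surj : forall x : Gam,
    (exists v, x = vpt v) \/
    (exists e t, 0 < t < len e /\ x = ept e t);
  mdist_path : forall x y : Gam,
    mdist x y = inf [set L | chain_to ept x y L]
}.

Definition metric_graph (R : realType) (Gam : metricType R) : Prop :=
  exists G : wgraph R, inhabited (realization Gam G).

Definition oept (R : realType) (Gam : metricType R) (G : wgraph R)
    (m : realization Gam G) (o : oedge G) (t : R) : Gam :=
  if o.2 then ept m o.1 t else ept m o.1 (len o.1 - t).

(* An outgoing unit tangent vector at x is a germ at 0 of unit speed geodesics
   starting at x. It is encoded by the set of all curves having this germ;
   curves are total functions, of which only the values on a small [0, eps]
   matter. *)
Definition unit_speed (R : realType) (Gam : metricType R) (x : Gam)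
    (c : R -> Gam) : Prop :=
  c 0 = x /\
  exists2 eps : R, 0 < eps &
    forall s t, 0 <= s <= eps -> 0 <= t <= eps -> mdist (c s) (c t) = `|s - t|.

Definition germ (R : realType) (Gam : metricType R) (x : Gam)
    (c : R -> Gam) : set (R -> Gam) :=
  [set c' | unit_speed x c' /\
     exists2 eps : R, 0 < eps & forall t, 0 <= t <= eps -> c' t = c t].

Definition tangent (R : realType) (Gam : metricType R) (x : Gam) : choiceType :=
  set_type [set germ x c | c in [set c | unit_speed x c]].

(* [parallel m nu o]: x lies on o, away from its head, and nu is the direction
   of o at x. *)
Definition parallel (R : realType) (Gam : metricType R) (G : wgraph R)
    (m : realization Gam G) (x : Gam) (nu : tangent x) (o : oedge G) : Prop :=
  exists2 s : R, 0 <= s < len o.1 & (val nu) (fun t => oept m o (s + t)).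

Definition rat_fun (R : realType) (Gam : metricType R) : set (Gam -> R) :=
  [set f | continuous f /\
    exists (G : wgraph R) (m : realization Gam G), forall e : edge G,
    exists k : int, forall t, 0 <= t <= len e ->
      f (ept m e t) = f (ept m e 0) + k%:~R * t].

(* The integer k below exists and is unique when f is in [rat_fun]. *)
Definition slope (R : realType) (Gam : metricType R) (x : Gam)
    (nu : tangent x) (f : Gam -> R) : int :=
  xget 0 [set k : int | exists2 c : R -> Gam, (val nu) c &
    exists2 eps : R, 0 < eps &
      forall t, 0 <= t <= eps -> f (c t) = f x + k%:~R * t].

Definition ord (R : realType) (Gam : metricType R) (x : Gam) (f : Gam -> R)
    : int :=
  - \sum_(nu \in [set: tangent x]) slope nu f.

Definition divisor (R : realType) (Gam : metricType R) : Type := {freeg Gam}.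

Definition effective (R : realType) (Gam : metricType R) (D : divisor Gam)
    : Prop :=
  forall x, 0 <= coeff x D.

(* The condition D + div(f) >= 0 is checked coefficientwise. *)
Definition rat_fun_div (R : realType) (Gam : metricType R) (D : divisor Gam)
    : set (Gam -> R) :=
  [set f | rat_fun f /\ forall x, 0 <= coeff x D + ord x f].

(* Points of the hypercube [r]^T, with T the finite index set of the
   coordinates, are functions T -> nat bounded by r. Functions on the hypercube
   are total functions on T -> nat, whose values off the hypercube are
   irrelevant. *)
Definition cube (T : Type) (r : nat) : set (T -> nat) :=
  [set a | forall i, (a i <= r)%N].

Definition unit_vec (T : choiceType) (i : T) : T -> nat := fun j => (j == i) : nat.

Definition rank_function (T : choiceType) (r : nat) (rho : (T -> nat) -> int)
    : Prop :=
  [/\ forall (i : T) (t : nat), (t <= r)%N ->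
        rho (fun j => t * unit_vec i j)%N = r%:Z - t%:Z,
      forall a b : T -> nat, cube r a -> cube r b ->
        (forall i, (a i <= b i)%N) -> rho b <= rho a,
      forall a b : T -> nat, cube r a -> cube r b ->
        rho a + rho b <=
        rho (fun i => maxn (a i) (b i)) + rho (fun i => minn (a i) (b i))
    & forall a : T -> nat, cube r a -> -1 <= rho a <= r%:Z].

Definition jump (T : choiceType) (r : nat) (rho : (T -> nat) -> int)
    (a : T -> nat) : Prop :=
  [/\ cube r a, 0 <= rho a
    & forall i, let b := (fun j => a j + unit_vec i j)%N in
        cube r b -> rho b = rho a - 1].

Definition standard_rank (T : choiceType) (r : nat) (a : T -> nat) : int :=
  Num.max (-1) (r%:Z - \sum_(i \in [set: T]) (a i)%:Z).

(* The rank functions are given at every point of Gam, already extended: off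
   the vertices they are prescribed. Their coordinates are indexed by tangent
   vectors. *)
Record slope_structure (R : realType) (Gam : metricType R) (r : nat) :=
  SlopeStructure {
  ss_graph : wgraph R;
  ss_model : realization Gam ss_graph;
  ss_simple : simple_graph ss_graph;
  ss_slopes : oedge ss_graph -> nat -> int;
  ss_slopes_lt : forall o i j, (i < j <= r)%N ->
    ss_slopes o i < ss_slopes o j;
  ss_slopes_rev : forall o i, (i <= r)%N ->
    ss_slopes o i + ss_slopes (orev o) (r - i)%N = 0;
  ss_rank : forall x : Gam, (tangent x -> nat) -> int;
  ss_rank_vert : forall v, rank_function r (@ss_rank (vpt ss_model v));
  ss_rank_std : forall x : Gam, (forall v, x <> vpt ss_model v) ->
    forall a : tangent x -> nat, cube r a -> ss_rank a = standard_rank r a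
}.

(* s_i^nu: there is exactly one oriented edge parallel to nu. *)
Definition slope_val (R : realType) (Gam : metricType R) (r : nat)
    (S : slope_structure Gam r) (x : Gam) (nu : tangent x) (i : nat) : int :=
  if [pick o | `[< parallel (ss_model S) nu o >]] is Some o
  then ss_slopes o i else 0.

Definition slope_set (R : realType) (Gam : metricType R) (r : nat)
    (S : slope_structure Gam r) (x : Gam) (nu : tangent x) : set int :=
  [set slope_val S nu i | i in [set i | (i <= r)%N]].

Definition slope_vectors (R : realType) (Gam : metricType R) (r : nat)
    (S : slope_structure Gam r) (x : Gam) : set (tangent x -> int) :=
  [set (fun nu => slope_val S nu (a nu))
     | a in [set a : tangent x -> nat | jump r (@ss_rank _ _ _ S x) a]].

Definition slope_structure_eq (R : realType) (Gam : metricType R) (r r' : nat)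
    (S : slope_structure Gam r) (S' : slope_structure Gam r') : Prop :=
  [/\ r = r',
      forall (x : Gam) (nu : tangent x), slope_set S nu = slope_set S' nu
    & forall (x : Gam) (a : tangent x -> nat), cube r a ->
        ss_rank S a = ss_rank S' a].

Definition dslope (R : realType) (Gam : metricType R) (x : Gam)
    (f : Gam -> R) : tangent x -> int :=
  fun nu => slope nu f.

Definition compatible (R : realType) (Gam : metricType R) (r : nat)
    (S : slope_structure Gam r) (f : Gam -> R) : Prop :=
  rat_fun f /\
  forall x : Gam, (forall nu : tangent x, slope_set S nu (slope nu f)) /\
                  slope_vectors S (dslope (x := x) f).

Definition rat_fun_ss (R : realType) (Gam : metricType R) (r : nat)
    (D : divisor Gam) (S : slope_structure Gam r) : set (Gam -> R) :=
  [set f | rat_fun_div D f /\ compatible S f].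

(* rho_x(d_x f), for f compatible with S: [index] recovers the unique point of
   the hypercube a with d_x f = s_a. *)
Definition rank_of (R : realType) (Gam : metricType R) (r : nat)
    (S : slope_structure Gam r) (x : Gam) (f : Gam -> R) : int :=
  ss_rank S (fun nu : tangent x =>
    index (slope nu f) (mkseq (slope_val S nu) r.+1)).

Definition semimodule (R : realType) (Gam : metricType R)
    (M : set (Gam -> R)) : Prop :=
  [/\ M `<=` @rat_fun R Gam,
      forall f g, M f -> M g -> M (fun x => Num.min (f x) (g x))
    & forall (f : Gam -> R) (c : R), M f -> M (fun x => f x + c)].

(* Closed in the space [rat_fun] for the topology of uniform convergence. *)
Definition uniformly_closed (R : realType) (Gam : metricType R)
    (M : set (Gam -> R)) : Prop :=
  closure (M : set {uniform Gam -> R}) `&` @rat_fun R Gam `<=` M.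

Definition admissible_with (R : realType) (Gam : metricType R) (r : nat)
    (D : divisor Gam) (M : set (Gam -> R)) (S : slope_structure Gam r) : Prop :=
  [/\ semimodule M,
      M `<=` rat_fun_div D,
      uniformly_closed M,
      M `<=` rat_fun_ss D S
    & forall E : divisor Gam, effective E -> deg E = r%:Z ->
        exists f : Gam -> R,
          [/\ M f,
              forall x, coeff x E <= rank_of S x f
            & forall x, 0 <= coeff x D + ord x f - coeff x E]].

Definition admissible (R : realType) (Gam : metricType R)
    (D : divisor Gam) (M : set (Gam -> R)) : Prop :=
  exists (r : nat) (S : slope_structure Gam r), admissible_with D M S.

(* Main.v *)
Require Import Defs.
From mathcomp Require Import all_boot all_order all_algebra.
From mathcomp Require Import all_classical all_reals all_analysis.
From mathcomp Require Import freeg zify lra.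

(** A slope structure is determined by its sets of slopes S^nu and by the jumps
    of its rank functions: the rank of a jump is the length of the longest chain
    of jumps above it ([rank_determined_by_jumps]). Both are visible on M. Indeed,
    for every x and every jump a of rho_x, some f in M has the slope vector s_a
    at x ([jump_attained]), the converse being compatibility. As every index
    i <= r is a coordinate of some jump, S^nu is then the set of slopes along nu
    of the elements of M ([slope_set_attained]), which gives r, the sets S^nu
    and the jumps.

    To attain a jump a, climb to it from 0 by jumps g_0 < g_1 < ... < g_n, with
    n = r - rho(a), where g_(j+1) is the least jump above g_j + e_nu for some
    coordinate nu; the rank drops by one at each step. Place points y_1, ..., y_n,
    y_j in the direction of the j-th step, each close enough to x given the
    previous ones, and let f in M correspond to the divisor
    E = rho(a) x + y_1 + ... + y_n. At an interior point of an edge the rank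
    function is standard, so that f is concave along the edges and its slope
    drops at each y_j: f has a kink there. These n kinks, together with
    rank at least rho(a) at x, force the slope index of f at x to be at least
    g_n = a ([exists_forcing]); being a jump of rank at least rho(a), it is a.

    The forcing is proved by induction on the number of kinks ([forces_step]). If
    it fails for every position of the last point y, take functions of M violating
    it with y tending to x. A subsequence converges in M, the last kink is
    absorbed by x, and the slope index at x strictly decreases; both indices are
    jumps, so the rank at x goes up by at least one. The induction hypothesis
    applies to the limit and shows that its index is at least g_j. The indices
    before the limit are then jumps above g_j + e_nu, hence above g_(j+1).

    Compactness of M ([admissible_compact]) holds because a compatible function is
    on each edge the minimum of r + 1 affine functions with prescribed slopes,
    hence given by finitely many bounded parameters; to see that the limit is
    in Rat(Gam) one subdivides the graph at its breakpoints ([refine_points]). The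
    identification of tangent vectors with oriented edges rests on a local
    description of the path metric, obtained from lower bounds by Lipschitz
    functions ([tent], [star], [unit_speed_edge]). *)

Set Implicit Arguments.
Unset Strict Implicit.
Unset Printing Implicit Defensive.

Import Order.TTheory GRing.Theory Num.Theory.
Import numFieldNormedType.Exports.

Local Open Scope classical_set_scope.
Local Open Scope ring_scope.

(** * Rank functions on hypercubes and their jumps *)

(** The coordinatewise order. *)
Definition cube_le (T : Type) (a b : T -> nat) : Prop :=
  forall i, (a i <= b i)%N.

Lemma cube_le_trans (T : Type) (a b c : T -> nat) :
  cube_le a b -> cube_le b c -> cube_le a c.
Proof. by move=> ab bc i; exact: leq_trans (ab i) (bc i). Qed.

(** The point a + e_i. *)
Definition incr (T : choiceType) (a : T -> nat) (i : T) : T -> nat :=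
  fun j => (a j + unit_vec i j)%N.

Lemma cube_le_incr (T : choiceType) (a : T -> nat) i : cube_le a (incr a i).
Proof. by move=> j; rewrite leq_addr. Qed.

Lemma incr_le (T : choiceType) (a b : T -> nat) i :
  cube_le a b -> (a i < b i)%N -> cube_le (incr a i) b.
Proof.
by move=> ab abi j; rewrite /incr /unit_vec; case: eqVneq => [->|_];
  rewrite ?addn1 ?addn0.
Qed.

Lemma cube_incr (T : choiceType) r (a : T -> nat) i :
  cube r a -> (a i < r)%N -> cube r (incr a i).
Proof.
by move=> ar air j; rewrite /incr /unit_vec; case: eqVneq => [->|_];
  rewrite ?addn1 ?addn0 //; exact: ar.
Qed.

Lemma cube_axis (T : choiceType) r (i : T) t : (t <= r)%N ->
  cube r (fun j => t * unit_vec i j)%N.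
Proof.
by move=> tr j; rewrite /unit_vec; case: (j == i); rewrite ?muln1 ?muln0.
Qed.

Lemma cube_le_cube (T : Type) r (a b : T -> nat) :
  cube_le a b -> cube r b -> cube r a.
Proof. by move=> ab br i; exact: leq_trans (ab i) (br i). Qed.

Section RankFunction.
Variables (T : choiceType) (r : nat) (rho : (T -> nat) -> int).
Hypothesis rhoP : rank_function r rho.

Lemma rank_anti a b : cube r b -> cube_le a b -> rho b <= rho a.
Proof.
by case: rhoP => _ h _ _ br ab; apply: h => //; exact: cube_le_cube ab br.
Qed.

Lemma rank_super a b : cube r a -> cube r b ->
  rho a + rho b <=
  rho (fun i => maxn (a i) (b i)) + rho (fun i => minn (a i) (b i)).
Proof. by case: rhoP => _ _ h _; exact: h. Qed.

Lemma rank_axis i t : (t <= r)%N -> rho (fun j => t * unit_vec i j)%N = r%:Z - t%:Z.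
Proof. by case: rhoP => h _ _ _; exact: h. Qed.

(** A rank function decreases by at most one along a unit step. *)
Lemma rank_incr a i : cube r a -> (a i < r)%N -> rho a - 1 <= rho (incr a i).
Proof.
move=> ar air.
have := rank_super ar (cube_axis i air).
have -> : (fun j => maxn (a j) ((a i).+1 * unit_vec i j)) = incr a i.
  apply/funext => j; rewrite /incr /unit_vec; case: eqVneq => [->|_]; lia.
have -> : (fun j => minn (a j) ((a i).+1 * unit_vec i j)) =
          (fun j => a i * unit_vec i j)%N.
  apply/funext => j; rewrite /unit_vec; case: eqVneq => [->|_]; lia.
rewrite !rank_axis ?(ltnW air) //.
lia.
Qed.

Lemma rank_coord a i : cube r a -> rho a <= r%:Z - (a i)%:Z.
Proof.
move=> ar; rewrite -(@rank_axis i) //; apply: rank_anti => // j.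
by rewrite /unit_vec; case: eqVneq => [->|_]; rewrite ?muln1 ?muln0.
Qed.

(** The rank drops strictly above a jump. *)
Lemma jump_lt_rank a b : jump r rho a -> cube r b -> cube_le a b ->
  (exists i, (a i < b i)%N) -> rho b <= rho a - 1.
Proof.
move=> [ar a0 aj] br ab [i abi].
have ib := incr_le ab abi.
rewrite -(aj i); last exact: cube_le_cube ib br.
exact: rank_anti.
Qed.

Lemma cube_le_antisym_ex (a b : T -> nat) :
  cube_le a b -> a = b \/ exists i, (a i < b i)%N.
Proof.
move=> ab; have [h|h] := pselect (exists i, (a i < b i)%N); [by right|left].
apply/funext => i; apply/eqP; rewrite eqn_leq ab /=.
by rewrite leqNgt; apply/negP => abi; apply: h; exists i.
Qed.

(** A jump that lies above [a] lies above every point that is above [a] and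
    has the same rank as [a]: the jump above [a] of the same rank is the least
    jump above [a]. *)
Lemma jump_ge_closure a b c : cube r b -> cube_le a b -> rho b = rho a ->
  jump r rho c -> cube_le a c -> cube_le b c.
Proof.
move=> br ab bE jc ac i; rewrite leqNgt; apply/negP => cbi.
have [cr _ _] := jc.
have /= := rank_super br cr.
set M := fun j => maxn _ _; set N := fun j => minn _ _.
have NM : rho N <= rho a.
  apply: rank_anti; first by move=> j; rewrite /N geq_min br.
  by move=> j; rewrite leq_min ab ac.
have MM : rho M <= rho c - 1.
  apply: jump_lt_rank => //.
  - by move=> j; rewrite /M geq_max br cr.
  - by move=> j; rewrite /M leq_maxr.
  - by exists i; rewrite /M leq_max cbi.
lia.
Qed.

Hypothesis finT : finite_set [set: T].

(** Going up as long as the rank does not drop leads to a jump; here the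
    finiteness of the set of coordinates is needed. *)
Lemma exists_closure a : cube r a -> 0 <= rho a ->
  exists b, [/\ jump r rho b, cube_le a b & rho b = rho a].
Proof.
have [s sP] : exists s : seq T, [set: T] = [set` s] by apply/finite_seqP.
have ins i : i \in s by have : [set` s] i by rewrite -sP.
pose mu b := (\sum_(i <- s) (r - b i))%N.
have [n] := ubnP (mu a); elim: n a => // n IHn a /ltnSE man ar a0.
have [j|nj] := pselect (jump r rho a); first by exists a; split.
have [i [air aE]] : exists i, (a i < r)%N /\ rho (incr a i) = rho a.
  apply: contrapT => /forallNP h; apply: nj; split => // i /= cb.
  have air : (a i < r)%N by have := cb i; rewrite /unit_vec eqxx addn1.
  have := rank_incr ar air; have := rank_anti cb (cube_le_incr a i).
  have := h i; rewrite -/(incr a i); lia.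
have ir := cube_incr ar air.
have [|//||b [jb ab bE]] := IHn (incr a i).
- apply: leq_trans man; rewrite /mu !(big_rem i (ins i)) /=.
  rewrite -addSn leq_add //.
    by rewrite /incr /unit_vec eqxx addn1; lia.
  by apply: leq_sum => j _; rewrite leq_sub2l // leq_addr.
- by rewrite aE.
- exists b; split=> //; last by rewrite bE.
  exact: cube_le_trans (cube_le_incr a i) ab.
Qed.

Lemma rank0 : inhabited T -> rho (fun _ => 0%N) = r%:Z.
Proof.
move=> [i]; have := @rank_axis i 0%N isT.
by rewrite subr0 => <-; congr rho; apply/funext => j.
Qed.

Lemma jump0 : inhabited T -> jump r rho (fun _ => 0%N).
Proof.
move=> inT; split => //; first by rewrite rank0.
move=> i /= cb; rewrite rank0 //.
have r1 : (1 <= r)%N by have := cb i; rewrite /unit_vec eqxx.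
rewrite -(@rank_axis i 1%N) //; congr rho; apply/funext => j.
by rewrite mul1n add0n.
Qed.

End RankFunction.

(** The rank at [a] is the rank of a jump above [a], and the rank of a jump is
    the length of the longest chain of jumps above it, so that the rank function
    can be read off its jumps. *)
Lemma rank_determined_by_jumps (T : choiceType) (r : nat)
    (rho rho' : (T -> nat) -> int) :
  finite_set [set: T] -> inhabited T ->
  rank_function r rho -> rank_function r rho' ->
  (forall a, jump r rho a <-> jump r rho' a) ->
  forall a, cube r a -> rho a = rho' a.
Proof.
move=> finT inT.
suff H (rho1 rho2 : (T -> nat) -> int) : rank_function r rho1 -> rank_function r rho2 ->
    (forall a, jump r rho1 a -> jump r rho2 a) ->
    forall n : nat, forall a, cube r a -> n%:Z <= rho1 a -> n%:Z <= rho2 a.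
  have K (rho1 rho2 : (T -> nat) -> int) : rank_function r rho1 -> rank_function r rho2 ->
      (forall a, jump r rho1 a -> jump r rho2 a) ->
      forall a, cube r a -> rho1 a <= rho2 a.
    move=> R1 R2 J a ar.
    case: R1 (R1) => _ _ _ /(_ _ ar) b1 R1.
    case: R2 (R2) => _ _ _ /(_ _ ar) b2 R2.
    have := H _ _ R1 R2 J `|rho1 a|%N a ar.
    by case: (lerP 0 (rho1 a)) => h; lia.
  move=> R1 R2 J a ar; apply/eqP; rewrite eq_le.
  by rewrite (K rho rho') // ?(K rho' rho) // => b /J.
move=> R1 R2 J; elim => [|n IHn] a ar an.
  have [b [jb ab _]] := exists_closure R1 finT ar an.
  have [br b0 _] := J _ jb.
  exact: le_trans b0 (rank_anti R2 br ab).
have a0 : 0 <= rho1 a by lia.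
have [b [jb ab bE]] := exists_closure R1 finT ar a0.
have [br _ _] := jb.
apply: (le_trans _ (rank_anti R2 br ab)).
case: inT => i.
have bir : (b i < r)%N by have := rank_coord R1 i br; lia.
have ir := cube_incr br bir.
have h1 : n%:Z <= rho1 (incr b i) by have := rank_incr R1 br bir; lia.
have h2 := IHn _ ir h1.
have [_ _ /(_ i) /= h3] := J _ jb.
by have := h3 ir; rewrite -/(incr b i); lia.
Qed.

Lemma fsum_unit_vec (T : choiceType) (i : T) (t : nat) :
  finite_set [set: T] ->
  \sum_(j \in [set: T]) (t * unit_vec i j)%:Z = t%:Z :> int.
Proof.
move=> finT; rewrite (fsbigD1 i) //=.
rewrite /unit_vec eqxx muln1 fsbig1 ?addr0 // => j [_ /= /eqP].
by case: eqVneq => // _ _; rewrite muln0.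
Qed.

(** Supermodularity comes from the convexity of [u |-> max (-1) (r - u)]. *)
Lemma standard_rank_function (T : choiceType) (r : nat) :
  finite_set [set: T] -> rank_function r (@standard_rank T r).
Proof.
move=> finT.
have mono (a b : T -> nat) : cube_le a b ->
    \sum_(i \in [set: T]) (a i)%:Z <= \sum_(i \in [set: T]) (b i)%:Z :> int.
  move=> ab; have bE j : (b j)%:Z = (a j)%:Z + (b j - a j)%N%:Z.
    by rewrite -PoszD subnKC.
  under [leRHS]eq_fsbigr do rewrite bE.
  rewrite fsbig_split //= lerDl.
  by apply: fsumr_ge0.
have split_mm (a b : T -> nat) :
    \sum_(i \in [set: T]) (a i)%:Z + \sum_(i \in [set: T]) (b i)%:Z =
    \sum_(i \in [set: T]) (maxn (a i) (b i))%:Z +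
    \sum_(i \in [set: T]) (minn (a i) (b i))%:Z :> int.
  rewrite -!fsbig_split //=; apply: eq_fsbigr => i _.
  by lia.
split.
- move=> i t tr; rewrite /standard_rank fsum_unit_vec //; lia.
- by move=> a b _ _ /mono; rewrite /standard_rank; lia.
- move=> a b _ _; rewrite /standard_rank.
  have := split_mm a b.
  have := @mono (fun i => minn (a i) (b i)) a (fun i => geq_minl _ _).
  have := @mono (fun i => minn (a i) (b i)) b (fun i => geq_minr _ _).
  lia.
- move=> a _; rewrite /standard_rank.
  have : 0 <= \sum_(i \in [set: T]) (a i)%:Z :> int.
    by apply: fsumr_ge0.
  lia.
Qed.

(** * The path metric of a realization *)

Section Chains.
Variables (R : realType) (T : Type) (G : wgraph R) (p : edge G -> R -> T).
Local Notation chain := (chain_to p).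

Lemma chain_ge0 x y L : chain x y L -> 0 <= L.
Proof. by elim=> [//|e s t {}L _ _ _ L0]; rewrite addr_ge0. Qed.

Lemma chain_trans x y z L L' : chain x y L -> chain y z L' -> chain x z (L + L').
Proof.
move=> xy; elim=> [|e s t {}L' hs ht _ IH]; first by rewrite addr0.
by rewrite addrA; exact: chain_step IH.
Qed.

Lemma chain_edge e s t : 0 <= s <= len e -> 0 <= t <= len e ->
  chain (p e s) (p e t) `|s - t|.
Proof.
move=> hs ht; rewrite -[`|_|]add0r; apply: chain_step => //.
exact: chain_nil.
Qed.

End Chains.

(** Chains can be transported along a map of segments to chains of the same
    length. *)
Lemma chain_simulate (R : realType) (T : Type) (G G' : wgraph R)
    (p : edge G -> R -> T) (p' : edge G' -> R -> T) x y L :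
  (forall e s t, 0 <= s <= len e -> 0 <= t <= len e ->
     chain_to p' (p e s) (p e t) `|s - t|) ->
  chain_to p x y L -> chain_to p' x y L.
Proof.
move=> h; elim=> [|e s t {}L hs ht _ IH]; first exact: chain_nil.
exact: chain_trans (h _ _ _ hs ht).
Qed.

Section PathMetric.
Variables (R : realType) (Gam : metricType R) (G : wgraph R).
Variable (m : realization Gam G).
Local Notation chain := (chain_to (ept m)).

Lemma len_ge0 (e : edge G) : 0 <= len e. Proof. exact/ltW/len_gt0. Qed.

Lemma in_edge0 (e : edge G) : (0 : R) <= 0 <= len e.
Proof. by rewrite lexx len_ge0. Qed.

Lemma in_edge1 (e : edge G) : (0 : R) <= len e <= len e.
Proof. by rewrite lexx len_ge0. Qed.

Lemma exists_edge : exists e : edge G, True.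
Proof.
by have := edge_gt0 G; rewrite lt0n => /pred0Pn [e]; exists e.
Qed.

Lemma point_on_edge_vertex v : exists e t, 0 <= t <= len e /\ vpt m v = ept m e t.
Proof.
have [e0 _] := exists_edge.
have [uv|uv] := eqVneq (src e0) v.
  by exists e0, 0; rewrite lexx len_ge0 ept_src uv.
have /connectP [p] := graph_connected (src e0) v.
case/lastP: p => [/= _ E|p w]; first by rewrite E eqxx in uv.
rewrite last_rcons rcons_path => /andP[_ /existsP[e he]] ->.
case/orP: he => /andP[/eqP h1 /eqP h2].
  by exists e, (len e); rewrite lexx len_ge0 ept_tgt h2.
by exists e, 0; rewrite lexx len_ge0 ept_src h1.
Qed.

Lemma point_on_edge x : exists e t, 0 <= t <= len e /\ x = ept m e t.
Proof.
have [[v ->]|[e [t [/andP[t0 tl] ->]]]] := realization_surj m x.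
  exact: point_on_edge_vertex.
by exists e, t; rewrite !ltW.
Qed.

Lemma chain_vertices u v : exists L, chain (vpt m u) (vpt m v) L.
Proof.
have /connectP [p] := graph_connected u v.
elim: p u => [|w p IH] u /= => [_ ->|/andP[/existsP[e he] hp] hl].
  by exists 0; exact: chain_nil.
have [L hL] := IH _ hp hl.
suff [L' hL'] : exists L, chain (vpt m u) (vpt m w) L.
  by exists (L' + L); exact: chain_trans hL.
have h0 := in_edge0 e; have h1 := in_edge1 e.
case/orP: he => /andP[/eqP <- /eqP <-]; rewrite -!ept_src -!ept_tgt.
  by exists `|0 - len e|; exact: chain_edge.
by exists `|len e - 0|; exact: chain_edge.
Qed.

Lemma chain_exists x y : exists L, chain x y L.
Proof.
have [e [s [hs ->]]] := point_on_edge x.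
have [e' [t [ht ->]]] := point_on_edge y.
have [L hL] := chain_vertices (src e) (src e').
have h0 := in_edge0.
exists ((`|s - 0| + L) + `|0 - t|).
apply: (chain_trans (y := ept m e' 0)); last exact: chain_edge.
apply: (chain_trans (y := ept m e 0)); first exact: chain_edge.
by rewrite !ept_src.
Qed.

Lemma mdist_le_chain x y L : chain x y L -> mdist x y <= L.
Proof.
move=> h; rewrite (mdist_path m); apply: ge_inf => //.
by exists 0 => l hl; exact: chain_ge0 hl.
Qed.

Lemma le_mdist x y c : (forall L, chain x y L -> c <= L) -> c <= mdist x y.
Proof.
move=> h; rewrite (mdist_path m); apply: lb_le_inf => //.
by have [L hL] := chain_exists x y; exists L.
Qed.

(** Phi is K-Lipschitz along each closed edge; nothing is asked of the points of
    [ept e] outside [0, len e]. *)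
Definition edge_lipschitz (K : R) (Phi : Gam -> R) : Prop :=
  forall e s t, 0 <= s <= len e -> 0 <= t <= len e ->
    `|Phi (ept m e s) - Phi (ept m e t)| <= K * `|s - t|.

Lemma chain_lipschitz K Phi x y L : edge_lipschitz K Phi ->
  chain x y L -> `|Phi x - Phi y| <= K * L.
Proof.
move=> hPhi; elim=> [|e s t {}L hs ht _ IH]; first by rewrite subrr normr0 mulr0.
have := hPhi e s t hs ht.
have := ler_normD (Phi x - Phi (ept m e s)) (Phi (ept m e s) - Phi (ept m e t)).
by rewrite addrA subrK mulrDr; lra.
Qed.

(** A function that is Lipschitz on every edge is Lipschitz for the path
    metric; distances are bounded below by exhibiting such functions. *)
Lemma mdist_lipschitz K Phi x y : 0 <= K -> edge_lipschitz K Phi ->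
  `|Phi x - Phi y| <= K * mdist x y.
Proof.
move=> K0 hPhi; have [KE|Kn0] := eqVneq K 0.
  have [L hL] := chain_exists x y.
  by have := chain_lipschitz hPhi hL; rewrite KE !mul0r.
have Kp : 0 < K by rewrite lt_def Kn0.
rewrite -ler_pdivrMl //; apply: le_mdist => L hL.
by rewrite ler_pdivrMl //; exact: chain_lipschitz hL.
Qed.

(** Functions on the edges that agree at the vertices glue. *)
Lemma glue_edges (gam : vert G -> R) (g : edge G -> R -> R) :
  (forall e, g e 0 = gam (src e)) -> (forall e, g e (len e) = gam (tgt e)) ->
  exists Phi : Gam -> R, (forall v, Phi (vpt m v) = gam v) /\
    (forall e t, 0 <= t <= len e -> Phi (ept m e t) = g e t).
Proof.
move=> g0 g1.
have ends e t v : 0 <= t <= len e -> ept m e t = vpt m v -> g e t = gam v.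
  move=> /andP[t0 tl] E.
  have [tE|tn0] := eqVneq t 0.
    by move: E; rewrite tE ept_src => /vpt_inj <-.
  have [tE|tnl] := eqVneq t (len e).
    by move: E; rewrite tE ept_tgt => /vpt_inj <-.
  exfalso; apply: ept_vpt E.
  by rewrite !lt_def t0 tl tn0 eq_sym tnl.
have H z : exists r : R, (forall v, z = vpt m v -> r = gam v) /\
    (forall e t, 0 <= t <= len e -> z = ept m e t -> r = g e t).
  have [[v ->]|[e [t [ht ->]]]] := realization_surj m z.
    exists (gam v); split=> [w /vpt_inj ->//|e t ht E].
    by apply/esym/ends.
  exists (g e t); split=> [w E|e' t' ht' E]; first by case: (ept_vpt ht E).
  have [[v E']|[e2 [t2 [ht2 E']]]] := realization_surj m (ept m e' t').
    by case: (@ept_vpt _ _ _ m _ _ v ht); rewrite E.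
  case/andP: (ht') => t'0 t'l.
  have : 0 < t' < len e'.
    rewrite lt_def t'0 andbT lt_neqAle t'l andbT; apply/andP; split.
      apply/eqP => E3; apply: (@ept_vpt _ _ _ m _ _ (src e') ht).
      by rewrite E E3 ept_src.
    apply/eqP => E3; apply: (@ept_vpt _ _ _ m _ _ (tgt e') ht).
    by rewrite E E3 ept_tgt.
  by move=> /(ept_inj ht) /(_ E) [-> ->].
have [Phi hPhi] := choice H.
exists Phi; split=> [v|e t ht]; first by have [h _] := hPhi (vpt m v); exact: h.
by have [_ h] := hPhi (ept m e t); exact: h.
Qed.

End PathMetric.

(** * Subdivision of the edges *)

Section SplitEdge.
Variables (R : realType) (Gam : metricType R) (G : wgraph R).
Variables (m : realization Gam G) (e0 : edge G) (s : R).
Hypothesis s_in : 0 < s < len e0.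

(* The new vertex is None. The edge e0 is cut into Some e0, of length s, and
   None, of length [len e0 - s]. *)
Let V : finType := option (vert G).
Let E : finType := option (edge G).
Let src' (e : E) : V := if e is Some e1 then Some (src e1) else None.
Let tgt' (e : E) : V :=
  if e is Some e1 then (if e1 == e0 then None else Some (tgt e1))
  else Some (tgt e0).
Let len' (e : E) : R :=
  if e is Some e1 then (if e1 == e0 then s else len e1) else len e0 - s.
Let ept' (e : E) (t : R) : Gam :=
  if e is Some e1 then ept m e1 t else ept m e0 (s + t).
Let vpt' (v : V) : Gam := if v is Some v1 then vpt m v1 else ept m e0 s.

Let len'_gt0 e : 0 < len' e.
Proof.
case/andP: s_in => s0 sl; case: e => [e|] /=; last by rewrite subr_gt0.
by case: eqP => // _; exact: len_gt0.
Qed.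

Let edge_gt0' : (0 < #|{: E}|)%N.
Proof. by rewrite card_option. Qed.

Let adj' : rel V := fun a b => [exists e, ((src' e == a) && (tgt' e == b))
                                 || ((src' e == b) && (tgt' e == a))].

Let adj'P e : connect adj' (src' e) (tgt' e) /\ connect adj' (tgt' e) (src' e).
Proof.
split; apply: connect1; apply/existsP; exists e; rewrite !eqxx //=.
by rewrite orbT.
Qed.

Let edge_connect e : connect adj' (Some (src e)) (Some (tgt e)) /\
  connect adj' (Some (tgt e)) (Some (src e)).
Proof.
have [a b] := adj'P (Some e); have [c d] := adj'P None.
move: a b c d => /=; case: eqP => [->|_] a b c d; last by [].
by split; [exact: connect_trans a c|exact: connect_trans d b].
Qed.

Let graph_connected' (u v : V) : connect adj' u v.
Proof.
have some w z : connect adj' (Some w) (Some z).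
  have /connectP [p] := graph_connected w z.
  elim: p w => [|y p IH] w /= => [_ ->|]; first exact: connect0.
  move=> /andP[/existsP[e he] hp] hl.
  apply: connect_trans (IH _ hp hl).
  have [h1 h2] := edge_connect e.
  by case/orP: he => /andP[/eqP <- /eqP <-].
have [_ h1] := adj'P None; have [h2 _] := adj'P None.
case: u v => [u|] [v|] //; try exact: connect0.
- exact: connect_trans (some u (tgt e0)) h1.
- exact: connect_trans h2 (some (tgt e0) v).
Qed.

(** The graph obtained by cutting e0 at the point of parameter s. *)
Definition split_graph : wgraph R :=
  @WGraph R V E src' tgt' len' len'_gt0 edge_gt0' graph_connected'.

Local Notation chain' := (@chain_to R Gam split_graph ept').

Let chain_sub x y L : chain' x y L -> chain_to (ept m) x y L.
Proof.
case/andP: s_in => s0 sl.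
apply: chain_simulate => -[e|] /= a b; last first.
  move=> /andP[a0 al] /andP[b0 bl].
  have -> : `|a - b| = `|(s + a) - (s + b)| by congr `|_|; lra.
  by apply: chain_edge; lra.
case: eqP => [->|_] ha hb; last exact: chain_edge.
by apply: chain_edge; lra.
Qed.

Let chain_sup x y L : chain_to (ept m) x y L -> chain' x y L.
Proof.
case/andP: s_in => s0 sl.
apply: chain_simulate => e a b ha hb.
have [eE|en] := eqVneq e e0; last first.
  have := @chain_edge _ _ split_graph ept' (Some e) a b.
  by rewrite /= (negbTE en); exact.
rewrite {}eE in ha hb *.
have lo c d : 0 <= c <= s -> 0 <= d <= s ->
    chain' (ept m e0 c) (ept m e0 d) `|c - d|.
  by have := @chain_edge _ _ split_graph ept' (Some e0) c d; rewrite /= eqxx.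
have hi c d : s <= c <= len e0 -> s <= d <= len e0 ->
    chain' (ept m e0 c) (ept m e0 d) `|c - d|.
  move=> hc hd.
  have := @chain_edge _ _ split_graph ept' None (c - s) (d - s).
  rewrite /= !subrKC.
  have -> : `|c - s - (d - s)| = `|c - d| by congr `|_|; lra.
  by apply; lra.
have ss1 : 0 <= s <= s by lra.
have ss2 : s <= s <= len e0 by lra.
case: (lerP a s) => ca; case: (lerP b s) => cb.
- by apply: lo; lra.
- have -> : `|a - b| = `|a - s| + `|s - b|.
    by rewrite !ler0_norm; lra.
  by apply: chain_trans; [apply: lo => //|apply: hi => //]; lra.
- have -> : `|a - b| = `|a - s| + `|s - b|.
    by rewrite !ger0_norm; lra.
  by apply: chain_trans; [apply: hi => //|apply: lo => //]; lra.
- by apply: hi; lra.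
Qed.

Let ept_src' e : ept' e 0 = vpt' (src' e).
Proof. by case: e => [e|] /=; [exact: ept_src|rewrite addr0]. Qed.

Let ept_tgt' e : ept' e (len' e) = vpt' (tgt' e).
Proof.
case: e => [e|] /=; last by rewrite subrKC ept_tgt.
by case: eqP => [->|_] //=; exact: ept_tgt.
Qed.

Let vpt_inj' : injective vpt'.
Proof.
move=> [u|] [v|] //= E'.
- by rewrite (vpt_inj E').
- by case: (@ept_vpt _ _ _ m e0 s u).
- by case: (@ept_vpt _ _ _ m e0 s v).
Qed.

(* Interior points of the new edges, seen in the old ones. *)
Let sub_edge (e : E) (t : R) : 0 < t < len' e ->
  exists e1 t1, [/\ 0 < t1 < len e1, ept' e t = ept m e1 t1,
    e = (if (e1 == e0) && (s < t1) then None else Some e1),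
    t = (if (e1 == e0) && (s < t1) then t1 - s else t1)
    & ~ (e1 = e0 /\ t1 = s)].
Proof.
case/andP: s_in => s0 sl.
case: e => [e|] /= ht; last first.
  exists e0, (s + t); rewrite eqxx /=.
  have -> : s < s + t by lra.
  split => //; [lra|lra|case=> _; lra].
have [eE|en] := eqVneq e e0; last first.
  rewrite (negbTE en) in ht; exists e, t; rewrite (negbTE en) /=.
  by split => // -[/eqP]; rewrite (negbTE en).
rewrite eE eqxx in ht *; exists e0, t; rewrite eqxx /=.
have -> : (s < t) = false by apply/negbTE; rewrite -leNgt; lra.
by split => //; [lra|case=> _; lra].
Qed.

Let ept_inj' e e' t t' : 0 < t < len' e -> 0 < t' < len' e' ->
  ept' e t = ept' e' t' -> e = e' /\ t = t'.
Proof.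
move=> /sub_edge [e1 [t1 [h1 -> -> -> _]]] /sub_edge [e2 [t2 [h2 -> -> -> _]]].
by move=> /(ept_inj h1 h2) [-> ->].
Qed.

Let ept_vpt' e t v : 0 < t < len' e -> ept' e t <> vpt' v.
Proof.
move=> /sub_edge [e1 [t1 [h1 -> _ _ n]]]; case: v => [v|] /=.
  exact: ept_vpt.
by move=> /(ept_inj h1 s_in).
Qed.

Let surj' (x : Gam) : (exists v, x = vpt' v) \/
  (exists e t, 0 < t < len' e /\ x = ept' e t).
Proof.
case/andP: s_in => s0 sl.
have [[v ->]|[e [t [ht ->]]]] := realization_surj m x.
  by left; exists (Some v).
have [eE|en] := eqVneq e e0; last first.
  by right; exists (Some e), t; rewrite /= (negbTE en).
rewrite {}eE in ht *; case: (ltgtP t s) => h.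
- by right; exists (Some e0), t; rewrite /= eqxx; split=> //; lra.
- by right; exists None, (t - s); rewrite /= subrKC; split=> //; lra.
- by left; exists None; rewrite h.
Qed.

Let mdist_path' (x y : Gam) : mdist x y = inf [set L | chain' x y L].
Proof.
rewrite (mdist_path m); congr inf; apply/seteqP.
by split => L; [exact: chain_sup|exact: chain_sub].
Qed.

(** The same metric space realizes the subdivided graph: chains for one graph
    are, up to cutting them at the new vertex, chains for the other. *)
Definition split_realization : realization Gam split_graph :=
  @Realization R Gam split_graph vpt' ept' ept_src' ept_tgt' vpt_inj' ept_inj'
    ept_vpt' surj' mdist_path'.

End SplitEdge.

(** Every edge of m' is a subsegment of an edge of m, with the same
    orientation, and the vertices of m are vertices of m'. *)
Definition refines (R : realType) (Gam : metricType R) (G' G : wgraph R)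
    (m' : realization Gam G') (m : realization Gam G) : Prop :=
  (forall e' : edge G', exists e off, [/\ 0 <= off, off + len e' <= len e &
     forall t, ept m' e' t = ept m e (off + t)]) /\
  (forall v, exists v', vpt m v = vpt m' v').

Lemma refines_refl (R : realType) (Gam : metricType R) (G : wgraph R)
  (m : realization Gam G) : refines m m.
Proof.
split=> [e|v]; last by exists v.
by exists e, 0; rewrite add0r; split => // t; rewrite add0r.
Qed.

Lemma refines_trans (R : realType) (Gam : metricType R) (G G' G'' : wgraph R)
  (m : realization Gam G) (m' : realization Gam G') (m'' : realization Gam G'') :
  refines m'' m' -> refines m' m -> refines m'' m.
Proof.
move=> [h1 k1] [h2 k2]; split=> [e|v].
  have [e' [a [a0 al aE]]] := h1 e; have [e2 [b [b0 bl bE]]] := h2 e'.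
  exists e2, (b + a); split => [||t]; [lra|lra|by rewrite aE bE addrA].
by have [v' ->] := k2 v; exact: k1.
Qed.

Lemma refine_point (R : realType) (Gam : metricType R) (G : wgraph R)
  (m : realization Gam G) (z : Gam) :
  exists (G' : wgraph R) (m' : realization Gam G'),
    refines m' m /\ exists v, z = vpt m' v.
Proof.
have [hz|[e [t [ht ->]]]] := realization_surj m z.
  by exists G, m; split=> //; exact: refines_refl.
exists (split_graph ht), (split_realization m ht).
split; last by exists None.
split=> [[e'|]|v]; last by exists (Some v).
- exists e', 0; split => [//||t' /=]; last by rewrite add0r.
  by rewrite /= add0r; case: eqP => // ->; rewrite ltW; case/andP: ht.
- exists e, t; split => //=; last by rewrite subrKC.
  by rewrite ltW; case/andP: ht.
Qed.

(** Finitely many points can be made vertices. *)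
Lemma refine_points (R : realType) (Gam : metricType R) (G : wgraph R)
  (m : realization Gam G) (P : seq Gam) :
  exists (G' : wgraph R) (m' : realization Gam G'),
    refines m' m /\ forall z, z \in P -> exists v, z = vpt m' v.
Proof.
elim: P => [|z P [G1 [m1 [r1 h1]]]].
  by exists G, m; split=> //; exact: refines_refl.
have [G2 [m2 [r2 h2]]] := refine_point m1 z.
exists G2, m2; split; first exact: refines_trans r1.
move=> y; rewrite inE => /orP[/eqP ->//|/h1 [v ->]].
by have [_ k] := r2; exact: k.
Qed.

(** * Tangent vectors and oriented edges *)

Lemma min_lip (R : realFieldType) (a b c d k : R) :
  `|a - c| <= k -> `|b - d| <= k -> `|Num.min a b - Num.min c d| <= k.
Proof.
rewrite !ler_norml => h1 h2.
by rewrite /Num.min; case: (ltP a b) => ab; case: (ltP c d) => cd; lra.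
Qed.

Lemma max_lip (R : realFieldType) (a b c d k : R) :
  `|a - c| <= k -> `|b - d| <= k -> `|Num.max a b - Num.max c d| <= k.
Proof.
rewrite !ler_norml => h1 h2.
by rewrite /Num.max; case: (ltP a b) => ab; case: (ltP c d) => cd; lra.
Qed.

Lemma le_norm_opp (R : realDomainType) (x y : R) : x = - y -> `|x| <= `|y|.
Proof. by move=> ->; rewrite normrN. Qed.

Variant min3_spec (R : realDomainType) (a b c : R) : R -> Prop :=
| Min3Left of a <= b & a <= c : min3_spec a b c a
| Min3Mid of b <= a & b <= c : min3_spec a b c b
| Min3Right of c <= a & c <= b : min3_spec a b c c.

Lemma min3P (R : realDomainType) (a b c : R) :
  min3_spec a b c (Num.min a (Num.min b c)).
Proof.
case: (leP b c) => bc; [case: (leP a b)|case: (leP a c)] => h.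
- by constructor; lra.
- by constructor; lra.
- by constructor; lra.
- by constructor; lra.
Qed.

Section Tangent.
Variables (R : realType) (Gam : metricType R) (G : wgraph R).
Variable (m : realization Gam G).

(** The origin of an oriented edge. *)
Definition tail (o : oedge G) : vert G := if o.2 then src o.1 else tgt o.1.

Lemma orevK (o : oedge G) : orev (orev o) = o.
Proof. by case: o => e b; rewrite /orev /= negbK. Qed.

Lemma oept0 o : oept m o 0 = vpt m (tail o).
Proof.
rewrite /oept /tail; case: ifP => _; first exact: ept_src.
by rewrite subr0 ept_tgt.
Qed.

Lemma oept_orev o t : oept m (orev o) t = oept m o (len o.1 - t).
Proof. by rewrite /oept /orev /=; case: o.2 => //=; rewrite subKr. Qed.

Lemma mdist_oept_le o s t : 0 <= s <= len o.1 -> 0 <= t <= len o.1 ->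
  mdist (oept m o s) (oept m o t) <= `|s - t|.
Proof.
move=> hs ht; apply: mdist_le_chain; rewrite /oept; case: ifP => _.
  exact: chain_edge.
have -> : `|s - t| = `|(len o.1 - s) - (len o.1 - t)|.
  by rewrite -normrN; congr `|_|; lra.
by apply: chain_edge; lra.
Qed.

(** A 1-Lipschitz function supported on the segment [a, b] of an oriented
    edge. *)
Lemma tent o a b : 0 <= a -> b <= len o.1 ->
  exists Phi : Gam -> R, [/\ edge_lipschitz m 1 Phi,
    forall t, 0 <= t <= len o.1 ->
      Phi (oept m o t) = Num.max 0 (Num.min (t - a) (b - t))
  & forall o' t, 0 <= t <= len o'.1 -> o'.1 != o.1 -> Phi (oept m o' t) = 0].
Proof.
move=> a0 bl.
have l0 := len_ge0 o.1.
pose g (u : R) := Num.max 0 (Num.min (u - a) (b - u)).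
have out u : u <= a \/ b <= u -> g u = 0.
  move=> h; apply/max_idPl; rewrite ge_min; case: h => h; apply/orP;
  [left|right]; lra.
have glip u w : `|g u - g w| <= `|u - w|.
  apply: max_lip; first by rewrite subrr normr0.
  apply: min_lip; first by rewrite (_ : u - a - (w - a) = u - w) //; lra.
  by apply: le_norm_opp; lra.
pose k (e : edge G) (t : R) : R :=
  if e == o.1 then g (if o.2 then t else len o.1 - t) else 0.
have [||Phi [_ hPhi]] := @glue_edges _ _ _ m (fun=> 0) k.
- by move=> e; rewrite /k; case: eqP => // _; case: o.2; apply: out; [left|right]; lra.
- move=> e; rewrite /k; case: eqP => // ->.
  by case: o.2; apply: out; [right|left]; lra.
exists Phi; split.
- move=> e s t hs ht; rewrite !hPhi // mul1r /k.
  case: ifP => _; last by rewrite subrr normr0.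
  case: o.2 => //; apply: le_trans (glip _ _) _.
  by apply: le_norm_opp; lra.
- move=> t ht; rewrite /oept; case E: o.2.
    by rewrite hPhi // /k eqxx E.
  by rewrite hPhi /k ?eqxx ?E ?subKr //; lra.
- move=> o' t ht ne; rewrite /oept.
  by case: ifP => _; rewrite hPhi /k ?(negbTE ne) //; lra.
Qed.

Lemma unit_speed_oept o s : 0 <= s < len o.1 ->
  unit_speed (oept m o s) (fun t => oept m o (s + t)).
Proof.
move=> hs; split; first by rewrite addr0.
pose ep := (len o.1 - s) / 2.
have ep0 : 0 < ep by rewrite /ep; lra.
exists ep => // t u ht hu.
have [||Phi [lip hPhi _]] := @tent o s (len o.1); [lra|lra|].
have h1 : 0 <= s + t <= len o.1 by rewrite /ep in ht; lra.
have h2 : 0 <= s + u <= len o.1 by rewrite /ep in hu; lra.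
apply/eqP; rewrite eq_le; apply/andP; split.
  apply: le_trans (mdist_oept_le h1 h2) _.
  by rewrite (_ : s + t - (s + u) = t - u) //; lra.
have := mdist_lipschitz (oept m o (s + t)) (oept m o (s + u)) ler01 lip.
rewrite mul1r !hPhi //.
have gE w : 0 <= w <= ep -> Num.max 0 (Num.min (s + w - s) (len o.1 - (s + w))) = w.
  rewrite /ep => hw; rewrite (min_idPl _) ?(max_idPr _) //; lra.
by rewrite !gE.
Qed.

Lemma len_lower : exists2 ep : R, 0 < ep & forall e : edge G, 4 * ep <= len e.
Proof.
have [e0 _] := exists_edge G.
have [e _ he] := @arg_minP _ R _ e0 xpredT (fun e => len e) isT.
exists (len e / 4); first by have := len_gt0 e; lra.
by move=> e1; have := he e1 isT; lra.
Qed.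

(** Near a vertex, the realization is a star: points are on the outgoing edges
    at their distance from the center, and two points on different branches are
    at least as far from each other as from the center. *)
Lemma star v : exists2 ep : R, 0 < ep &
  (forall z, mdist (vpt m v) z < ep ->
     exists2 o, tail o = v & z = oept m o (mdist (vpt m v) z)) /\
  (forall o o' s t, tail o = v -> tail o' = v -> o != o' -> 0 <= s < ep ->
     0 <= t < ep -> s <= mdist (oept m o s) (oept m o' t)).
Proof.
have [ep ep0 hep] := len_lower; exists ep => //; split.
- move=> z hz.
  (* The distance to v along the edge, truncated at ep. *)
  pose k (e : edge G) (t : R) : R :=
    Num.min (if src e == v then t else ep)
      (Num.min (if tgt e == v then len e - t else ep) ep).
  have [||Phi [Pv hPhi]] := @glue_edges _ _ _ m (fun u => if u == v then 0 else ep) k.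
  + move=> e; have := hep e; rewrite /k => h.
    by case: min3P; case: (src e == v); case: (tgt e == v); lra.
  + move=> e; have := hep e; rewrite /k => h.
    by case: min3P; case: (src e == v); case: (tgt e == v); lra.
  have lip : edge_lipschitz m 1 Phi.
    move=> e s t hs ht; rewrite mul1r !hPhi // /k.
    have z0 (c : R) : `|c - c| <= `|s - t| by rewrite subrr normr0.
    apply: min_lip; first by case: ifP.
    apply: min_lip => //; case: ifP => // _.
    by apply: le_norm_opp; lra.
  have := mdist_lipschitz (vpt m v) z ler01 lip.
  rewrite Pv eqxx mul1r sub0r normrN.
  have [e [t [ht zE]]] := point_on_edge m z.
  move=> h1; have {h1} : Phi z <= mdist (vpt m v) z.
    by apply: le_trans h1; exact: ler_norm.
  rewrite zE hPhi // -zE => h1.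
  have key o (u : R) : tail o = v -> 0 <= u <= len o.1 -> z = oept m o u ->
      u <= mdist (vpt m v) z -> z = oept m o (mdist (vpt m v) z).
    move=> to hu E h; have := @mdist_oept_le o 0 u (in_edge0 _) hu.
    rewrite oept0 to -E sub0r normrN ger0_norm; last by case/andP: hu.
    by move=> h'; rewrite {1}E; congr oept; lra.
  have h2 : k e t < ep by exact: le_lt_trans hz.
  have hl := hep e.
  have zT : z = oept m (e, true) t by [].
  have zF : z = oept m (e, false) (len e - t) by rewrite /oept /= subKr.
  move: h1 h2; rewrite /k; case: min3P => h3 h4.
  + case: eqP h3 h4 => [sv|_] h3 h4 h1 h2; last by rewrite ltxx in h2.
    by exists (e, true) => //; apply: key zT h1.
  + case: eqP h3 h4 => [tv|_] h3 h4 h1 h2; last by rewrite ltxx in h2.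
    by exists (e, false) => //; apply: key zF h1 => //=; lra.
  + by rewrite ltxx.
- move=> o o' s t to to' oo' hs ht.
  have hl := hep o.1; have hl' := hep o'.1.
  have [||Phi [lip h1 h2]] := @tent o 0 (2 * ep); [lra|lra|].
  have := mdist_lipschitz (oept m o s) (oept m o' t) ler01 lip.
  rewrite mul1r h1; last by lra.
  have -> : Num.max 0 (Num.min (s - 0) (2 * ep - s)) = s.
    by rewrite (min_idPl _) ?(max_idPr _) //; lra.
  suff -> : Phi (oept m o' t) = 0 by rewrite subr0; apply: le_trans; exact: ler_norm.
  have [E|n] := eqVneq o'.1 o.1; last by apply: h2 => //; lra.
  have -> : o' = orev o.
    move: oo' E; rewrite /orev; case: o o' {to to' hl hl' h1 h2} => [e b] [e' b'] /=.
    move=> ne E; rewrite E in ne *; congr pair.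
    by case: b b' ne => [] [] //; rewrite eqxx.
  rewrite oept_orev h1; last by lra.
  apply/max_idPl; rewrite ge_min; apply/orP; right; lra.
Qed.

End Tangent.

(** A unit speed curve starting at a vertex cannot change branches, because the
    points of two distinct branches are too far apart. *)
Lemma unit_speed_vertex (R : realType) (Gam : metricType R) (G : wgraph R)
    (m : realization Gam G) v c : unit_speed (vpt m v) c ->
  exists o, exists2 ep : R, 0 < ep &
    forall t, 0 <= t <= ep -> c t = oept m o t.
Proof.
move=> [c0 [e1 e10 hc]]; have [e2 e20 [near far]] := star m v.
pose et := Num.min e1 (e2 / 2).
have et1 : et <= e1 by rewrite ge_min lexx.
have et2 : et <= e2 / 2 by rewrite ge_min lexx orbT.
have et0 : 0 < et by rewrite lt_min e10; lra.
have dist (t : R) : 0 <= t <= et -> mdist (vpt m v) (c t) = t.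
  move=> ht; rewrite -c0 hc; [|lra|lra].
  by rewrite sub0r normrN ger0_norm //; lra.
have on (t : R) : 0 <= t <= et -> exists2 o, tail o = v & c t = oept m o t.
  move=> ht; have := near (c t); rewrite dist //; apply; lra.
have [|o to co] := on et; first by lra.
exists o, et => // t ht.
have [ o' to' co'] := on t ht.
have [ oo|oo] := eqVneq o o'; first by rewrite oo.
have [t0|tn0] := eqVneq t 0; first by rewrite t0 c0 oept0 to.
have tp : 0 < t by rewrite lt_def tn0; case/andP: ht.
have := far o o' et t to to' oo; rewrite -co -co' hc; [|lra|lra].
rewrite ger0_norm; last by lra.
move=> h; have h2 : et <= et - t by apply: h; lra.
by exfalso; clear c0 co co'; lra.
Qed.

(** A unit speed curve starts along an edge: subdivide so that its origin is a
    vertex. *)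
Lemma unit_speed_edge (R : realType) (Gam : metricType R) (G : wgraph R)
    (m : realization Gam G) x c : unit_speed x c ->
  exists (o : oedge G) (s : R), 0 <= s < len o.1 /\
    exists2 ep : R, 0 < ep & forall t, 0 <= t <= ep -> c t = oept m o (s + t).
Proof.
have [G' [m' [[r _] [v ->]]]] := refine_point m x.
move=> /unit_speed_vertex [[e' b] [ep ep0 hc]].
have [e [ off [ off0 offl hE]]] := r e'.
have l0 := len_gt0 e'.
case: b hc => hc.
  exists (e, true), off => /=; split; first by lra.
  by exists ep => // t /hc ->; exact: hE.
exists (e, false), (len e - off - len e') => /=; split; first by lra.
exists ep => // t /hc ->; rewrite /oept /= hE; congr ept; lra.
Qed.

(** Two oriented edges that agree along a nontrivial segment are equal. *)
Lemma parallel_unique (R : realType) (Gam : metricType R) (G : wgraph R)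
    (m : realization Gam G) (o o' : oedge G) s s' ep :
  0 <= s < len o.1 -> 0 <= s' < len o'.1 -> 0 < ep ->
  (forall t, 0 <= t <= ep -> oept m o (s + t) = oept m o' (s' + t)) ->
  o = o' /\ s = s'.
Proof.
case: o o' => [e b] [e' b'] /= hs hs' ep0 h.
pose d := Num.min ep (Num.min (len e - s) (len e' - s')) / 2.
have d0 : 0 < d.
  rewrite /d divr_gt0 // lt_min ep0 lt_min; lra.
have [d1 d2 d3] : [/\ d < ep, s + d < len e & s' + d < len e'].
  by move: d0; rewrite /d; case: min3P => ? ? ?; split; lra.
have key (t : R) : 0 < t <= d -> e = e' /\
    (if b then s + t else len e - (s + t)) =
    (if b' then s' + t else len e' - (s' + t)).
  move=> ht; have /h : 0 <= t <= ep by lra.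
  have F (e1 : edge G) b1 u : oept m (e1, b1) u = ept m e1 (if b1 then u else len e1 - u).
    by case: b1.
  rewrite !F; apply: (@ept_inj _ _ _ m).
    by case: ifP => _; lra.
  by case: ifP => _; lra.
have [|E E1] := key d; first by lra.
have [|_ E2] := key (d / 2); first by lra.
subst e'; case: b b' E1 E2 {h key} => [] [] E1 E2.
- by split => //; lra.
- by exfalso; lra.
- by exfalso; lra.
- by split => //; lra.
Qed.

Section TangentVectors.
Variables (R : realType) (Gam : metricType R).
Implicit Types (x : Gam) (c : R -> Gam).

Lemma tangent_germ x (nu : tangent x) :
  exists2 c, unit_speed x c & val nu = germ x c.
Proof. by case: nu => A /= /[dup] /set_mem [c hc <-]; exists c. Qed.

Lemma tangent_unit_speed x (nu : tangent x) c : (val nu) c -> unit_speed x c.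
Proof. by have [c0 _ ->] := tangent_germ nu; case. Qed.

Lemma tangent_start x (nu : tangent x) c : (val nu) c -> c 0 = x.
Proof. by move=> /tangent_unit_speed []. Qed.

Lemma tangent_agree x (nu : tangent x) c c' : (val nu) c -> (val nu) c' ->
  exists2 ep : R, 0 < ep & forall t, 0 <= t <= ep -> c t = c' t.
Proof.
have [c0 _ ->] := tangent_germ nu.
move=> [_ [e1 e10 h1]] [_ [e2 e20 h2]].
exists (Num.min e1 e2); first by rewrite lt_min e10.
move=> t; rewrite le_min => /andP[t0 /andP[t1 t2]].
by rewrite h1 ?h2 ?t0.
Qed.

Lemma tangent_curve x (nu : tangent x) c c' ep : (val nu) c -> unit_speed x c' ->
  0 < ep -> (forall t, 0 <= t <= ep -> c' t = c t) -> (val nu) c'.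
Proof.
have [c0 _ ->] := tangent_germ nu.
move=> [_ [e1 e10 h1]] uc' ep0 h; split=> //.
exists (Num.min e1 ep); first by rewrite lt_min e10.
move=> t; rewrite le_min => /andP[t0 /andP[t1 t2]].
by rewrite h ?h1 ?t0.
Qed.

Lemma tangent_eq x (nu nu' : tangent x) c : (val nu) c -> (val nu') c -> nu = nu'.
Proof.
move=> h h'; apply: val_inj; apply/seteqP.
have [c0 u0 E] := tangent_germ nu; have [c1 u1 E1] := tangent_germ nu'.
by split=> d hd;
  have [ep ep0 hep] := tangent_agree hd (ltac:(first [exact: h | exact: h']));
  apply: (tangent_curve (c := c) _ _ ep0) => //; exact: tangent_unit_speed hd.
Qed.

(** The tangent vector of a unit speed curve. *)
Definition tangent_of x c (h : unit_speed x c) : tangent x :=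
  SigSub (mem_set (imageP (germ x) h)).

Lemma tangent_ofP x c (h : unit_speed x c) : (val (tangent_of h)) c.
Proof. by split=> //; exists 1. Qed.

Variables (G : wgraph R) (m : realization Gam G).

(** Every tangent vector is the direction of an oriented edge, which is unique
    by [parallel_inj_edge]; by [parallel_inj] the tangent vectors at x inject
    into the oriented edges. *)
Lemma parallel_exists x (nu : tangent x) : exists o, parallel m nu o.
Proof.
have [c uc E] := tangent_germ nu.
have hc : (val nu) c by rewrite E; split=> //; exists 1.
have [ o [s [hs [ep ep0 h]]]] := unit_speed_edge m uc.
exists o, s => //.
have xE : x = oept m o s.
  by rewrite -(tangent_start hc) h ?addr0 // lexx ltW.
apply: (tangent_curve hc _ ep0) => [|t /h //].
by rewrite {1}xE; exact: unit_speed_oept.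
Qed.

Lemma parallel_inj_edge x (nu : tangent x) o o' :
  parallel m nu o -> parallel m nu o' -> o = o'.
Proof.
move=> [s hs h] [s' hs' h'].
have [ep ep0 hep] := tangent_agree h h'.
by have [] := parallel_unique hs hs' ep0 hep.
Qed.

Lemma parallel_start x (nu : tangent x) o : parallel m nu o ->
  exists s, [/\ 0 <= s < len o.1, x = oept m o s
    & (val nu) (fun t => oept m o (s + t))].
Proof.
by move=> [s hs h]; exists s; split => //; rewrite -(tangent_start h) addr0.
Qed.

Lemma oept_inj o s s' : 0 <= s < len o.1 -> 0 <= s' < len o.1 ->
  oept m o s = oept m o s' -> s = s'.
Proof.
move=> hs hs' E.
have F u : oept m o u = ept m o.1 (if o.2 then u else len o.1 - u).
  by rewrite /oept; case: ifP.
have int u : 0 < u < len o.1 -> 0 < (if o.2 then u else len o.1 - u) < len o.1.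
  by case: ifP; lra.
have [s0|s0] := eqVneq s 0; have [s'0|s'0] := eqVneq s' 0.
- by rewrite s0 s'0.
- exfalso; move: E; rewrite s0 oept0 F => /esym; apply: ept_vpt; apply: int.
  by rewrite lt_def s'0; lra.
- exfalso; move: E; rewrite s'0 oept0 F; apply: ept_vpt; apply: int.
  by rewrite lt_def s0; lra.
- have i1 : 0 < s < len o.1 by rewrite lt_def s0; lra.
  have i2 : 0 < s' < len o.1 by rewrite lt_def s'0; lra.
  move: E; rewrite !F => /(ept_inj (int _ i1) (int _ i2)) [_].
  by case: ifP => _; lra.
Qed.

Lemma parallel_inj x (nu nu' : tangent x) o :
  parallel m nu o -> parallel m nu' o -> nu = nu'.
Proof.
move=> /parallel_start [s [hs xE h]] /parallel_start [s' [hs' xE' h']].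
have sE : s = s' by apply: (oept_inj hs hs'); rewrite -xE -xE'.
by rewrite sE in h; exact: tangent_eq h h'.
Qed.

Lemma finite_tangent x : finite_set [set: tangent x].
Proof.
have [F hF] := choice (@parallel_exists x).
have -> : [set: tangent x] = F @^-1` [set: oedge G] by rewrite preimage_setT.
apply: finite_preimage; last exact: finite_finset.
move=> nu nu' _ _ E; apply: parallel_inj (hF nu) _.
by rewrite E; exact: hF.
Qed.

Lemma inhabited_tangent x : inhabited (tangent x).
Proof.
have [e [t [ht xE]]] := point_on_edge m x.
have [tl|tl] := ltP t (len e).
  have hs : 0 <= t < len (e, true).1 by rewrite /= tl; case/andP: ht => ->.
  have := unit_speed_oept m hs; rewrite -[ oept _ _ _]/(ept m e t) -xE => u.
  exact: inhabits (tangent_of u).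
have hs : (0 : R) <= 0 < len (e, false).1 by rewrite lexx len_gt0.
have := unit_speed_oept m hs; rewrite /oept /= subr0.
have -> : len e = t by case/andP: ht => _ ht; apply/eqP; rewrite eq_le tl.
rewrite -xE => u.
exact: inhabits (tangent_of u).
Qed.

(** The direction of the oriented edge o at its point of parameter s. *)
Lemma tangent_along o s : 0 <= s < len o.1 ->
  exists2 nu : tangent (oept m o s), parallel m nu o &
    (val nu) (fun t => oept m o (s + t)).
Proof.
move=> hs; have u := unit_speed_oept m hs.
by exists (tangent_of u); [exists s => //|]; exact: tangent_ofP.
Qed.

End TangentVectors.

(** * Concavity along an edge *)

Lemma real_induction (R : realType) (P : R -> Prop) (a b : R) : P a ->
  (forall t, a <= t < b -> P t ->
     exists2 d : R, 0 < d & forall u, t <= u <= t + d -> P u) ->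
  (forall t, a < t <= b -> (forall u, a <= u < t -> P u) -> P t) ->
  forall t, a <= t <= b -> P t.
Proof.
move=> Pa step lim.
have [ab|ba] := leP a b; last by move=> t; lra.
pose A := [set t | a <= t <= b /\ forall u, a <= u <= t -> P u].
have Aa : A a.
  split; first by rewrite lexx.
  by move=> u hu; have -> : u = a by lra.
have ubA : ubound A b by move=> t [/andP[_ ?] _].
have hsA : has_sup A by split; [exists a | exists b].
have aT : a <= sup A by apply: ub_le_sup Aa; exists b.
have Tb : sup A <= b by apply: ge_sup => //; exists a.
have below u : a <= u < sup A -> P u.
  move=> hu; have e0 : 0 < sup A - u by lra.
  have [t [ht Pt] htu] := sup_adherent e0 hsA.
  by apply: Pt; lra.
have PT : P (sup A).
  have [-> //|Tna] := eqVneq (sup A) a.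
  by apply: lim => //; rewrite Tb andbT lt_def Tna.
have upto u : a <= u <= sup A -> P u.
  move=> hu; have [->//|un] := eqVneq u (sup A).
  by apply: below; rewrite lt_neqAle un; lra.
suff TE : sup A = b by move=> t ht; apply: upto; rewrite TE.
apply/eqP; rewrite eq_le Tb /= leNgt; apply/negP => Tltb.
have [|d d0 hd] := step (sup A) _ PT; first by rewrite aT.
pose t := Num.min (sup A + d) b.
have t1 : t <= sup A + d by rewrite ge_min lexx.
have t2 : t <= b by rewrite ge_min lexx orbT.
have t3 : sup A < t by rewrite lt_min Tltb andbT; lra.
have : A t.
  split; first by rewrite t2; lra.
  move=> u hu; have [uT|uT] := leP u (sup A); first by apply: upto; lra.
  by apply: hd; lra.
by move=> /(ub_le_sup (proj2 hsA)); lra.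
Qed.

(** [phi] is affine with slope [p] on the right of [t]. *)
Definition right_affine (R : realType) (phi : R -> R) (t p : R) : Prop :=
  exists2 ep : R, 0 < ep & forall h, 0 <= h <= ep -> phi (t + h) = phi t + p * h.

(** [phi] is affine on the left of [t]; [q] is the outgoing slope, that is,
    the opposite of the left derivative. *)
Definition left_affine (R : realType) (phi : R -> R) (t q : R) : Prop :=
  exists2 ep : R, 0 < ep & forall h, 0 <= h <= ep -> phi (t - h) = phi t + q * h.

Lemma right_affine_inj (R : realType) (phi : R -> R) t p p' :
  right_affine phi t p -> right_affine phi t p' -> p = p'.
Proof.
move=> [e1 e10 h1] [e2 e20 h2].
pose d := Num.min e1 e2.
have d1 : d <= e1 by rewrite ge_min lexx.
have d2 : d <= e2 by rewrite ge_min lexx orbT.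
have d0 : 0 < d by rewrite lt_min e10.
have hd : 0 <= d <= e1 by lra.
have hd' : 0 <= d <= e2 by lra.
have dn : d != 0 by rewrite gt_eqF.
by have := h1 _ hd; rewrite h2 // => /addrI /(mulIf dn).
Qed.

(** A function that is affine on both sides of every point and has
    nonincreasing slopes lies below its half-tangents. *)
Lemma concave_half_tangent (R : realType) (phi : R -> R) (a b p : R) :
  (forall t, a <= t < b -> exists p, right_affine phi t p) ->
  (forall t, a < t <= b -> exists q, left_affine phi t q) ->
  (forall t p q, a < t < b -> right_affine phi t p -> left_affine phi t q ->
     p + q <= 0) ->
  right_affine phi a p ->
  forall t, a <= t <= b -> phi t <= phi a + p * (t - a).
Proof.
move=> hR hL hC hp.
suff H : forall t, a <= t <= b -> phi t <= phi a + p * (t - a) /\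
    (t < b -> forall p', right_affine phi t p' -> p' <= p).
  by move=> t /H [].
apply: real_induction.
- split=> [|_ p' hp']; first by rewrite subrr mulr0 addr0.
  by rewrite (right_affine_inj hp hp').
- move=> t ht [h1 h2].
  have [p1 hp1] := hR t ht.
  have p1p : p1 <= p by apply: h2 => //; lra.
  case: hp1 => e e0 he; exists (e / 2); first by lra.
  move=> u hu.
  have hu' : 0 <= u - t <= e by lra.
  have uE : phi u = phi t + p1 * (u - t) by rewrite -he // subrKC.
  have key : p1 * (u - t) <= p * (u - t) by rewrite ler_wpM2r //; lra.
  split; first by rewrite uE; lra.
  move=> _ p' hp'; suff -> : p' = p1 by [].
  apply: right_affine_inj hp' _; exists (e / 2); first by lra.
  move=> h hh; have hk : 0 <= u + h - t <= e by lra.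
  have := he _ hk; rewrite subrKC => ->; rewrite uE; lra.
- move=> t ht IH.
  have [q hq] := hL t ht; have [e e0 he] := hq.
  pose d := Num.min e (t - a) / 2.
  have de : d <= e / 2 by rewrite ler_pM2r ?invr_gt0 // ge_min lexx.
  have da : d <= (t - a) / 2 by rewrite ler_pM2r ?invr_gt0 // ge_min lexx orbT.
  have d0 : 0 < d by rewrite divr_gt0 // lt_min e0; lra.
  have [|h1 h2] := IH (t - d); first by lra.
  have hd : 0 <= d <= e by lra.
  have dE := he d hd.
  have hr : right_affine phi (t - d) (- q).
    exists d => // h hh; have hh' : 0 <= d - h <= e by lra.
    have := he _ hh'; rewrite dE => E.
    have -> : t - d + h = t - (d - h) by lra.
    by rewrite E; lra.
  have qp : - q <= p by apply: h2 => //; lra.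
  split.
    have : (- q) * d <= p * d by rewrite ler_wpM2r //; lra.
    by lra.
  move=> tb p' hp'; have : p' + q <= 0 by apply: (hC t) => //; lra.
  by lra.
Qed.

Section Compatible.
Variables (R : realType) (Gam : metricType R).

(** The slope of a function of Rat(Gam) along nu is computed by any curve
    representing nu. *)
Lemma slope_in_curve (f : Gam -> R) (x : Gam) (nu : tangent x) c : rat_fun f ->
  (val nu) c -> exists2 ep : R, 0 < ep &
    forall t, 0 <= t <= ep -> f (c t) = f x + (slope nu f)%:~R * t.
Proof.
move=> [_ [G [m hf]]] hc.
have [ o [s [hs [e e0 he]]]] := unit_speed_edge m (tangent_unit_speed hc).
have [k hk] := hf o.1.
have ex : exists k : int, exists2 c : R -> Gam, (val nu) c &
    exists2 ep : R, 0 < ep &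
      forall t, 0 <= t <= ep -> f (c t) = f x + k%:~R * t.
  exists (if o.2 then k else - k), c => //.
  exists (Num.min e (len o.1 - s)); first by rewrite lt_min e0; lra.
  move=> t; rewrite le_min => /andP[t0 /andP[t1 t2]].
  have fx : f x = f (oept m o s) by rewrite -(tangent_start hc) he ?addr0 // lexx ltW.
  rewrite fx he ?t0 // /oept; case: o.2 => /=.
    rewrite (hk (s + t)) ?(hk s) ?mulrDr ?addrA //; last by lra.
    by apply/andP; split; lra.
  rewrite (hk (len o.1 - (s + t))) ?(hk (len o.1 - s)).
  - by rewrite -addrA rmorphN mulNr -mulrBr; congr (_ + _ * _); lra.
  - by lra.
  - by apply/andP; split; lra.
have := xgetPex 0 ex; rewrite -/(slope nu f) => -[c1 hc1 [e1 e10 h1]].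
have [e2 e20 h2] := tangent_agree hc hc1.
exists (Num.min e1 e2); first by rewrite lt_min e10.
move=> t; rewrite le_min => /andP[t0 /andP[t1 t2]].
by rewrite h2 ?h1 ?t0.
Qed.

Variables (r : nat) (S : slope_structure Gam r).
Local Notation m := (ss_model S).

Lemma slope_valE x (nu : tangent x) o i : parallel m nu o ->
  slope_val S nu i = ss_slopes o i.
Proof.
rewrite /slope_val => h; case: pickP => [ o' /asboolP h'|/(_ o) /asboolP //].
by rewrite (parallel_inj_edge h h').
Qed.

Lemma slope_val_lt x (nu : tangent x) i j : (i < j <= r)%N ->
  slope_val S nu i < slope_val S nu j.
Proof.
by have [ o h] := parallel_exists m nu; rewrite !(slope_valE _ h);
  exact: ss_slopes_lt.
Qed.

Lemma slope_val_le x (nu : tangent x) i j : (i <= r)%N -> (j <= r)%N ->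
  (slope_val S nu i <= slope_val S nu j) = (i <= j)%N.
Proof.
move=> ir jr; case: (ltngtP i j) => ij.
- by rewrite ltW // slope_val_lt // ij.
- by apply/negbTE; rewrite -ltNge slope_val_lt // ij.
- by rewrite ij lexx.
Qed.

Lemma slope_val_inj x (nu : tangent x) i j : (i <= r)%N -> (j <= r)%N ->
  slope_val S nu i = slope_val S nu j -> i = j.
Proof.
move=> ir jr E; apply/eqP; rewrite eqn_leq.
by rewrite -(slope_val_le nu ir jr) -(slope_val_le nu jr ir) E lexx.
Qed.

Lemma ss_slopes_le o i j : (i <= j)%N -> (j <= r)%N ->
  ss_slopes (s := S) o i <= ss_slopes o j.
Proof.
move=> ij jr; have [->//|n] := eqVneq i j.
by apply/ltW/ss_slopes_lt; rewrite jr andbT ltn_neqAle n.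
Qed.

(** The point of the hypercube given by the slopes of f at x. A coordinate is
    r + 1 if the corresponding slope is not in S^nu. *)
Definition slope_index (x : Gam) (f : Gam -> R) : tangent x -> nat :=
  fun nu => index (slope nu f) (mkseq (slope_val S nu) r.+1).

Arguments slope_index x f nu : clear implicits.

Lemma rank_ofE x f : rank_of S x f = ss_rank S (slope_index x f).
Proof. by []. Qed.

Lemma slope_index_eq x f (a : tangent x -> nat) : cube r a ->
  (forall nu, slope nu f = slope_val S nu (a nu)) -> slope_index x f = a.
Proof.
move=> ar h; apply/funext => nu; rewrite /slope_index h.
have ha : (a nu < r.+1)%N by rewrite ltnS ar.
rewrite -[X in index X _](nth_mkseq 0 (slope_val S nu) ha).
rewrite index_uniq ?size_mkseq //.
apply/mkseq_uniqP => i j; rewrite !inE !ltnS => ir jr.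
exact: slope_val_inj.
Qed.

Lemma slope_indexP x f : compatible S f ->
  jump r (@ss_rank _ _ _ S x) (slope_index x f) /\
  forall nu, slope nu f = slope_val S nu (slope_index x f nu).
Proof.
move=> [_ /(_ x) [_ [a ja E]]].
have E' nu : slope nu f = slope_val S nu (a nu).
  by rewrite -[LHS]/(dslope f nu) -E.
by have [ar _ _] := ja; rewrite (slope_index_eq ar E').
Qed.

(** The rank functions of a slope structure are rank functions also off the
    vertices. *)
Lemma ss_rankP x : rank_function r (@ss_rank _ _ _ S x).
Proof.
have [[v ->]|nv] := pselect (exists v, x = vpt m v); first exact: ss_rank_vert.
have finx := finite_tangent m x.
have std (a : tangent x -> nat) : cube r a -> ss_rank S a = standard_rank r a.
  by move=> ar; apply: ss_rank_std => // v xv; apply: nv; exists v.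
have [h1 h2 h3 h4] := standard_rank_function r finx.
split.
- by move=> i t tr; rewrite std ?h1 //; exact: cube_axis.
- by move=> a b ar br ab; rewrite !std // h2.
- move=> a b ar br; rewrite !std //; first exact: h3.
    by move=> i; rewrite geq_min ar.
  by move=> i; rewrite geq_max ar br.
- by move=> a ar; rewrite std // h4.
Qed.

Variable f : Gam -> R.
Hypothesis cf : compatible S f.

Let rf : rat_fun f. Proof. by case: cf. Qed.

(** The slope along nu is the right derivative along the parallel edge. *)
Lemma tangent_at x o s : 0 <= s < len o.1 -> x = oept m o s ->
  exists2 nu : tangent x, parallel m nu o &
    right_affine (fun t => f (oept m o t)) s (slope nu f)%:~R.
Proof.
move=> hs ->; have [nu pnu hnu] := tangent_along m hs; exists nu => //.
by have [ep ep0 h] := slope_in_curve rf hnu; exists ep.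
Qed.

Lemma compatible_right_affine o s : 0 <= s < len o.1 ->
  exists2 i, (i <= r)%N &
    right_affine (fun t => f (oept m o t)) s (ss_slopes o i)%:~R.
Proof.
move=> hs; have [nu pnu h] := tangent_at hs erefl.
have [/(_ nu) [i /= ir E] _] := proj2 cf (oept m o s).
by exists i => //; rewrite -(slope_valE i pnu) E.
Qed.

(** At an interior point of an edge the rank function is standard, which bounds
    the rank by r - i - j if i and j are the indices of the two outgoing slopes. *)
Lemma compatible_interior o s : 0 < s < len o.1 ->
  exists i j, [/\ (i <= r)%N, (j <= r)%N,
    right_affine (fun t => f (oept m o t)) s (ss_slopes o i)%:~R,
    right_affine (fun t => f (oept m (orev o) t)) (len o.1 - s)
      (ss_slopes (orev o) j)%:~R
    & 0 <= rank_of S (oept m o s) f <= r%:Z - i%:Z - j%:Z].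
Proof.
move=> hs; pose x := oept m o s.
have hs1 : 0 <= s < len o.1 by lra.
have hs2 : 0 <= len o.1 - s < len (orev o).1 by rewrite /=; lra.
have [nu pnu h] := tangent_at hs1 (erefl x).
have xE : x = oept m (orev o) (len o.1 - s) by rewrite oept_orev subKr.
have [nu' pnu' h'] := tangent_at hs2 xE.
have [ja E] := slope_indexP x cf.
have [ar a0 _] := ja.
exists (slope_index x f nu), (slope_index x f nu'); split => //.
- by rewrite -(slope_valE _ pnu) -E.
- by rewrite -(slope_valE _ pnu') -E.
rewrite rank_ofE -/x a0 /=.
have xv v : x <> vpt m v.
  rewrite /x /oept; case: ifP => _; apply: ept_vpt => //; lra.
rewrite (ss_rank_std xv ar).
have finx := finite_tangent m x.
have nn : nu <> nu'.
  move=> E1; have := parallel_inj_edge pnu; rewrite E1 => /(_ _ pnu').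
  by case: (o) => e b; rewrite /orev /= => -[]; case: b.
have sum2 : (slope_index x f nu)%:Z + (slope_index x f nu')%:Z <=
    \sum_(i \in [set: tangent x]) (slope_index x f i)%:Z :> int.
  rewrite (fsbigD1 nu) //= (fsbigD1 nu') /=; last 2 first.
  - exact: finite_setD.
  - by split=> // /esym.
  by rewrite addrA lerDl; apply: fsumr_ge0.
have := a0; rewrite (ss_rank_std xv ar) /standard_rank.
lia.
Qed.

(** Since [s_j] of the reversed edge is the opposite of [s_(r-j)], two outgoing
    slopes of indices i and j at an interior point have a nonpositive sum if
    i + j <= r, and a negative sum if i + j < r. *)
Lemma ss_slopes_sum (o : oedge (ss_graph S)) i j (k : nat) :
  (i <= r)%N -> (j <= r)%N ->
  (k <= 1)%N -> (i + j + k <= r)%N -> ss_slopes o i + ss_slopes (orev o) j <= - k%:Z.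
Proof.
move=> ir jr k1 h.
have E := ss_slopes_rev (s := S) (orev o) jr.
rewrite orevK in E.
have [k0|kn0] := eqVneq k 0%N.
  have : ss_slopes o i <= ss_slopes (s := S) o (r - j) by apply: ss_slopes_le; lia.
  lia.
have : ss_slopes o i < ss_slopes (s := S) o (r - j) by apply: ss_slopes_lt; lia.
lia.
Qed.

Lemma left_affine_orev o s q :
  right_affine (fun t => f (oept m (orev o) t)) (len o.1 - s) q <->
  left_affine (fun t => f (oept m o t)) s q.
Proof.
by split=> -[ep ep0 h]; exists ep => // t /h; rewrite !oept_orev subKr;
  (have -> : len o.1 - (len o.1 - s + t) = s - t by lra).
Qed.

(** Along an edge, a compatible function lies below its half-tangents. *)
Lemma compatible_half_tangent o s p t : 0 <= s < len o.1 ->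
  right_affine (fun t => f (oept m o t)) s p -> s <= t <= len o.1 ->
  f (oept m o t) <= f (oept m o s) + p * (t - s).
Proof.
move=> hs hp ht.
apply: (concave_half_tangent (phi := fun t => f (oept m o t)) _ _ _ hp ht).
- move=> u hu; have [|i _ h] := @compatible_right_affine o u; first by lra.
  by eexists; exact: h.
- move=> u hu; have [|i _ h] := @compatible_right_affine (orev o) (len o.1 - u).
    by rewrite /=; lra.
  by eexists; apply/left_affine_orev; exact: h.
- move=> u p1 q1 hu h1 /left_affine_orev h2.
  have [|i [j [ir jr hi hj hr]]] := @compatible_interior o u; first by lra.
  rewrite (right_affine_inj h1 hi) (right_affine_inj h2 hj).
  rewrite -intrD lerz0.
  by have := @ss_slopes_sum o i j 0 ir jr isT; rewrite addn0 oppr0; apply; lia.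
Qed.

Lemma compatible_half_tangent_back o s q t : 0 < s <= len o.1 ->
  right_affine (fun t => f (oept m (orev o) t)) (len o.1 - s) q ->
  0 <= t <= s -> f (oept m o t) <= f (oept m o s) + q * (s - t).
Proof.
move=> hs hq ht.
have := @compatible_half_tangent (orev o) _ _ (len o.1 - t) _ hq.
by rewrite !oept_orev !subKr /= (_ : len o.1 - t - _ = s - t);
  [apply; lra | lra].
Qed.

End Compatible.

Arguments slope_index {R Gam r} S x f nu.

(** * Limits of compatible functions *)

(** On [0, l], [phi] is the minimum of the affine functions
    [t |-> al i + s i * t]. *)
Definition min_form (R : realType) (n : nat) (s : 'I_n -> int) (l : R)
    (phi : R -> R) (al : 'I_n -> R) : Prop :=
  forall t, 0 <= t <= l ->
    (forall i, phi t <= al i + (s i)%:~R * t) /\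
    exists i, phi t = al i + (s i)%:~R * t.

(** The parameter at which the lines i and j meet. Parallel lines get the
    irrelevant value 0. *)
Definition crossing (R : realType) (n : nat) (s : 'I_n -> int) (al : 'I_n -> R)
    (i j : 'I_n) : R :=
  (al j - al i) / ((s i)%:~R - (s j)%:~R).

(** Between two consecutive crossings, a minimum of affine functions is affine. *)
Lemma min_form_affine (R : realType) (n : nat) (s : 'I_n -> int) (l : R)
    (phi : R -> R) (al : 'I_n -> R) u v : min_form s l phi al ->
  0 <= u -> u < v -> v <= l ->
  (forall i j, ~ (u < crossing s al i j < v)) ->
  exists i, forall t, u <= t <= v -> phi t = al i + (s i)%:~R * t.
Proof.
move=> mf u0 uv vl nc; pose w := (u + v) / 2.
have [|le_w [i iE]] := mf w; first by rewrite /w; lra.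
exists i => t ht.
have [|le_t [j jE]] := mf t; first by lra.
apply/eqP; rewrite eq_le le_t /= jE leNgt; apply/negP => lt_ji.
have := le_w j; rewrite iE => le_ij.
pose d : R := (s j)%:~R - (s i)%:~R; pose b := crossing s al i j.
have dn0 : d != 0.
  apply/eqP => d0.
  have E : (s j)%:~R = (s i)%:~R :> R by rewrite /d in d0; lra.
  by rewrite E in lt_ji le_ij; lra.
have bE : d * b = al i - al j.
  rewrite /b /crossing mulrC -mulrA.
  have -> : (s i)%:~R - (s j)%:~R = - d :> R by rewrite /d; lra.
  by rewrite invrN mulNr mulVf // mulrN1; lra.
have h1 : 0 <= d * (w - b) by rewrite mulrBr bE /d; lra.
have h2 : d * (t - b) < 0 by rewrite mulrBr bE /d; lra.
have ub : u < w by rewrite /w; lra.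
have wb : w < v by rewrite /w; lra.
apply: (nc i j); rewrite -/b.
move: dn0; rewrite neq_lt => /orP[dn|dp].
  by move: h1 h2; rewrite nmulr_rge0 // nmulr_rlt0 //; lra.
by move: h1 h2; rewrite pmulr_rge0 // pmulr_rlt0 //; lra.
Qed.

(** Subdividing at the crossings exhibits a function of this form as an
    element of Rat(Gam). *)
Lemma rat_fun_min_form (R : realType) (Gam : metricType R) (G : wgraph R)
    (m : realization Gam G) (f : Gam -> R) (n : nat)
    (s : edge G -> 'I_n -> int) (al : edge G -> 'I_n -> R) :
  continuous f ->
  (forall e, min_form (s e) (len e) (fun t => f (ept m e t)) (al e)) ->
  rat_fun f.
Proof.
move=> cf mf; split=> //.
pose P := [seq ept m x.1.1 (crossing (s x.1.1) (al x.1.1) x.1.2 x.2)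
          | x <- enum {: edge G * 'I_n * 'I_n}].
have [G' [m' [[rf _] hP]]] := refine_points m P.
exists G', m' => e'; have [e [ off [ o0 ol hE]]] := rf e'.
have l0 := len_gt0 e'.
have [ | | | |i hi] := min_form_affine (u := off) (v := off + len e') (mf e).
- by [].
- by lra.
- by [].
- move=> i j hb; set b := crossing _ _ _ _ in hb.
  have [|v vE] := hP (ept m e b).
    by apply/mapP; exists (e, i, j) => //; rewrite mem_enum.
  have hb' : 0 < b - off < len e' by lra.
  by apply: (ept_vpt hb' (v := v) (r := m')); rewrite hE subrKC.
exists (s e i) => t ht; rewrite !hE !hi; lra.
Qed.

Section Bounds.
Variables (R : realType) (Gam : metricType R) (r : nat).
Variable (S : slope_structure Gam r).
Local Notation m := (ss_model S).

Lemma slopes_bounded : exists2 K : R, 0 <= K & forall o i, (i <= r)%N ->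
  `|(ss_slopes (s := S) o i)%:~R| <= K.
Proof.
pose F (x : oedge (ss_graph S) * 'I_r.+1) : R := `|(ss_slopes x.1 x.2)%:~R|.
exists (\sum_x F x); first by apply: sumr_ge0 => x _; exact: normr_ge0.
move=> o i ir; rewrite (bigD1 (o, inord i)) //= {1}/F /= inordK // lerDl.
by apply: sumr_ge0 => x _; exact: normr_ge0.
Qed.

Variable f : Gam -> R.
Hypothesis cf : compatible S f.

(** A compatible function lies, on the whole edge, below a line through any of
    its points, with slope in S. *)
Lemma supporting_line o t : 0 <= t <= len o.1 -> exists2 i, (i <= r)%N &
  forall u, 0 <= u <= len o.1 ->
    f (oept m o u) <= f (oept m o t) + (ss_slopes o i)%:~R * (u - t).
Proof.
move=> ht.
have [t0|tn0] := eqVneq t 0.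
  have [|i ir hi] := compatible_right_affine cf (o := o) (s := t).
    by rewrite t0 lexx len_gt0.
  exists i => // u hu; apply: (compatible_half_tangent cf _ hi); last by lra.
  by rewrite t0 lexx len_gt0.
have tp : 0 < t by rewrite lt_def tn0; case/andP: ht.
have [tl|tl] := ltP t (len o.1).
  have [|i [j [ir jr hi hj hr]]] := compatible_interior cf (o := o) (s := t).
    by rewrite tp.
  have sum : (ss_slopes o i)%:~R + (ss_slopes (orev o) j)%:~R <= 0 :> R.
    rewrite -intrD lerz0.
    by have := @ss_slopes_sum _ _ _ S o i j 0 ir jr isT; rewrite addn0 oppr0; apply; lia.
  exists i => // u hu; have [tu|ut] := leP t u.
    by apply: (compatible_half_tangent cf _ hi); lra.
  have := @compatible_half_tangent_back _ _ _ _ _ cf o t _ u _ hj.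
  move=> h; apply: (le_trans (h _ _)); [lra|lra|].
  have : (ss_slopes (orev o) j)%:~R * (t - u) <= (- (ss_slopes o i)%:~R) * (t - u) :> R.
    by apply: ler_wpM2r; lra.
  by lra.
have tE : t = len o.1 by lra.
have [|j jr hj] := compatible_right_affine cf (o := orev o) (s := len o.1 - t).
  by rewrite tE subrr lexx len_gt0.
exists (r - j)%N; first exact: leq_subr.
move=> u hu; have := @compatible_half_tangent_back _ _ _ _ _ cf o t _ u _ hj.
move=> h; apply: (le_trans (h _ _)); [lra|lra|].
have E := ss_slopes_rev (s := S) (orev o) jr.
rewrite orevK in E.
have -> : ss_slopes (s := S) o (r - j) = - ss_slopes (orev o) j by lia.
by rewrite rmorphN /=; lra.
Qed.

Lemma compatible_edge_lipschitz K :
  (forall o i, (i <= r)%N -> `|(ss_slopes (s := S) o i)%:~R| <= K) ->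
  edge_lipschitz m K f.
Proof.
move=> hK e s t hs ht.
have half (u w : R) : 0 <= u <= len e -> 0 <= w <= len e ->
    f (ept m e w) - f (ept m e u) <= K * `|s - t| \/ `|w - u| <> `|s - t|.
  move=> hu hw; have [E|] := pselect (`|w - u| = `|s - t|); [left|by right].
  have [i ir hi] := @supporting_line (e, true) u hu.
  have := hi w hw; rewrite -[oept _ _ _]/(ept m e w) -[oept _ _ _]/(ept m e u).
  have := hK (e, true) i ir.
  set c : R := _%:~R => cK h.
  have : c * (w - u) <= K * `|s - t|.
    rewrite -E; apply: (le_trans (ler_norm _)); rewrite normrM.
    by rewrite ler_wpM2r.
  by lra.
rewrite ler_norml; apply/andP; split.
  by have [|] := half s t hs ht; [lra|rewrite distrC].
by have [|] := half t s ht hs; [lra|].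
Qed.

(** The coefficient of index i is the supremum of [f - s_i t] on the edge; this
    choice bounds the coefficients uniformly. *)
Lemma compatible_min_form K B e :
  (forall o i, (i <= r)%N -> `|(ss_slopes (s := S) o i)%:~R| <= K) ->
  (forall t, 0 <= t <= len e -> `|f (ept m e t)| <= B) ->
  exists2 al : 'I_r.+1 -> R,
    min_form (fun i : 'I_r.+1 => ss_slopes (e, true) i) (len e)
      (fun t => f (ept m e t)) al
    & forall i, `|al i| <= B + K * len e.
Proof.
move=> hK hB; have l0 := len_ge0 e.
pose sl (i : 'I_r.+1) : R := (ss_slopes (s := S) (e, true) i)%:~R.
pose X i := [set f (ept m e t) - sl i * t | t in [set t | 0 <= t <= len e]].
have Xb i x : X i x -> `|x| <= B + K * len e.
  move=> [t /= ht <-].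
  apply: (le_trans (ler_normB _ _)); apply: lerD; first exact: hB.
  rewrite normrM (ger0_norm (_ : 0 <= t)); last by lra.
  apply: ler_pM => //; [lra| |lra].
  by apply: hK; rewrite -ltnS.
have X0 i : X i !=set0 by exists (f (ept m e 0) - sl i * 0), 0; rewrite //= in_edge0.
have ubX i : ubound (X i) (B + K * len e).
  by move=> x /Xb; rewrite ler_norml => /andP[].
have hsX i : has_sup (X i) by split; [exact: X0 | eexists; exact: ubX].
exists (fun i => sup (X i)).
  move=> t ht; split=> [i|].
    rewrite -lerBlDr; apply: (ub_le_sup (proj2 (hsX i))).
    by exists t.
  have [i ir hi] := @supporting_line (e, true) t ht.
  have ilt : (i < r.+1)%N by rewrite ltnS.
  exists (Ordinal ilt); apply/eqP; rewrite -subr_eq eq_le; apply/andP; split.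
    by apply: (ub_le_sup (proj2 (hsX _))); exists t.
  apply: ge_sup => // _ [u /= hu <-].
  have := hi u hu; rewrite -[oept _ _ _]/(ept m e u) -[oept _ _ _]/(ept m e t).
  by rewrite /sl /=; lra.
move=> i; rewrite ler_norml; apply/andP; split; last exact: ge_sup.
have [x hx] := X0 i.
apply: (le_trans _ (ub_le_sup (proj2 (hsX i)) hx)).
by have := Xb i x hx; rewrite ler_norml => /andP[].
Qed.

End Bounds.

(** An ultrafilter makes all bounded sequences converge simultaneously, which
    spares the extraction of successive subsequences. *)
Lemma ultra_bounded_cvg (R : realType) (U : set_system nat) (u : nat -> R) B :
  UltraFilter U -> (forall n, `|u n| <= B) ->
  exists l, forall ep, 0 < ep -> U [set n | `|u n - l| <= ep].
Proof.
move=> UU hB.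
have cpt := @segment_compact R (- B) B.
have [|l [_ cl]] := cpt (u @ U) _.
  apply: (@filterE _ U _ (u @^-1` `[- B, B]%classic)) => n.
  by rewrite /= in_itv /= -ler_norml.
exists l => ep ep0.
have [//|h] := in_ultra_setVsetC [set n | `|u n - l| <= ep] UU.
exfalso.
have [||y [/= hy1 hy2]] := cl [set y | ~ `|y - l| <= ep] (ball l ep).
- exact: h.
- exact: nbhsx_ballx.
by apply: hy1; rewrite distrC; apply: ltW; move: hy2; rewrite -ball_normE.
Qed.

Section Limit.
Variables (R : realType) (Gam : metricType R) (r : nat).
Variables (S : slope_structure Gam r) (D : divisor Gam) (M : set (Gam -> R)).
Hypothesis admM : admissible_with D M S.
Local Notation m := (ss_model S).

Lemma admissible_compatible f : M f -> compatible S f.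
Proof. by case: admM => _ _ _ h _ /h []. Qed.

(** Normalized sequences of M converge, along an ultrafilter, to elements of M:
    on each edge, the coefficients of the min-form converge. *)
Lemma admissible_compact (U : set_system nat) (x : Gam) (f : nat -> Gam -> R) :
  UltraFilter U -> (forall n, M (f n)) -> (forall n, f n x = 0) ->
  exists2 g, M g & forall z ep, 0 < ep -> U [set n | `|f n z - g z| <= ep].
Proof.
move=> UU Mf fx.
have [K K0 hK] := slopes_bounded S.
have lip n := compatible_edge_lipschitz (admissible_compatible (Mf n)) hK.
have bnd n z : `|f n z| <= K * mdist x z.
  by rewrite -[f n z]subr0 -(fx n) distrC; exact: mdist_lipschitz (lip n).
have [g hg] := choice (fun z => ultra_bounded_cvg UU (fun n => bnd n z)).
have lipg : edge_lipschitz m K g.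
  move=> e s t hs ht; apply/ler_addgt0Pl => ep ep0.
  have ep2 : 0 < ep / 2 by lra.
  have [n [/= h1 h2]] := filter_ex (filterI (hg (ept m e s) _ ep2) (hg (ept m e t) _ ep2)).
  have := lip n e s t hs ht.
  have := ler_distD (f n (ept m e s)) (g (ept m e s)) (g (ept m e t)).
  have := ler_distD (f n (ept m e t)) (f n (ept m e s)) (g (ept m e t)).
  by rewrite (distrC (g (ept m e s)) (f n (ept m e s))); lra.
have contg : continuous g.
  move=> z; apply/cvgrPdist_le => ep ep0.
  have K1 : 0 < K + 1 by lra.
  near=> w.
  apply: (le_trans (mdist_lipschitz z w K0 lipg)).
  have : mdist z w <= ep / (K + 1).
    apply/ltW; have : ball z (ep / (K + 1)) w.
      by near: w; apply: nbhsx_ballx; rewrite divr_gt0.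
    by rewrite ballEmdist.
  rewrite ler_pdivlMr // => h; apply: le_trans h.
  by rewrite mulrDr mulr1 mulrC lerDl mdist_ge0.
have [B hB] : exists B, forall n (e : edge (ss_graph S)) t, 0 <= t <= len e ->
    `|f n (ept m e t)| <= B e.
  exists (fun e => K * mdist x (ept m e 0) + K * len e) => n e t ht.
  have := lip n e 0 t (in_edge0 _) ht; have := bnd n (ept m e 0).
  rewrite sub0r normrN (ger0_norm (_ : 0 <= t)); last by lra.
  have : K * t <= K * len e by rewrite ler_wpM2l //; lra.
  have := ler_distD (f n (ept m e 0)) (f n (ept m e t)) 0.
  by rewrite !subr0 (distrC (f n (ept m e t)) (f n (ept m e 0))); lra.
have [al0 hal0] := choice (fun p : nat * edge (ss_graph S) =>
  (let: ex_intro2 a h1 h2 := compatible_min_form (admissible_compatible (Mf p.1)) hK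
     (hB p.1 p.2) in ex_intro _ a (conj h1 h2))).
pose al n e := al0 (n, e).
have mf n e : min_form (fun i : 'I_r.+1 => ss_slopes (e, true) i) (len e)
    (fun t => f n (ept m e t)) (al n e) by exact: (proj1 (hal0 (n, e))).
have alb n e i : `|al n e i| <= B e + K * len e by exact: (proj2 (hal0 (n, e))).
have [be hbe] := choice (fun p : edge (ss_graph S) * 'I_r.+1 =>
  @ultra_bounded_cvg R U (fun n => al n p.1 p.2) _ UU (fun n => alb n p.1 p.2)).
have unif ep : 0 < ep -> U [set n | forall e i, `|al n e i - be (e, i)| <= ep].
  move=> ep0.
  have : \forall n \near U, forall p : edge (ss_graph S) * 'I_r.+1,
      `|al n p.1 p.2 - be p| <= ep.
    by apply: filter_forall => p; exact: hbe.
  by apply: filterS => n h e i; exact: (h (e, i)).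
have approx ep e t : 0 < ep -> 0 <= t <= len e ->
    (forall i, g (ept m e t) <= be (e, i) + (ss_slopes (e, true) i)%:~R * t + ep) /\
    (exists i, be (e, i) + (ss_slopes (e, true) i)%:~R * t <= g (ept m e t) + ep).
  move=> ep0 ht; have ep2 : 0 < ep / 2 by lra.
  have [n [/= h1 h2]] := filter_ex (filterI (unif _ ep2) (hg (ept m e t) _ ep2)).
  have [h3 [i h4]] := mf n e t ht; move: h2; rewrite ler_norml => h2.
  split=> [j|]; last exists i.
    by have := h1 e j; have := h3 j; rewrite ler_norml -/(al n e); lra.
  by have := h1 e i; move: h4; rewrite ler_norml -/(al n e); lra.
have mfg e : min_form (fun i : 'I_r.+1 => ss_slopes (e, true) i) (len e)
      (fun t => g (ept m e t)) (fun i => be (e, i)).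
  move=> t ht.
  have low i : g (ept m e t) <= be (e, i) + (ss_slopes (e, true) i)%:~R * t.
    by apply/ler_addgt0Pr => ep ep0; have [h _] := approx ep e t ep0 ht.
  split=> //.
  pose F i : R := be (e, i) + (ss_slopes (e, true) i)%:~R * t.
  have [i _ hi] := @arg_minP _ R _ (ord0 : 'I_r.+1) xpredT F isT.
  exists i; apply/eqP; rewrite eq_le low /=; apply/ler_addgt0Pr => ep ep0.
  have [_ [j hj]] := approx ep e t ep0 ht.
  exact: le_trans (hi j isT) hj.
have rg : rat_fun g by exact: rat_fun_min_form contg mfg.
exists g => //.
have [_ _ clM _ _] := admM.
apply: clM; split => //= V /uniform_nbhs [E [entE EV]].
have [ep /= ep0 hE] : exists2 ep : R, 0 < ep & forall y z : R, `|y - z| < ep -> E (y, z).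
  move: entE; rewrite -entourage_ballE => -[ep /= ep0 h]; exists ep => // y z yz.
  by apply: h; rewrite /= -ball_normE.
have ep2 : 0 < ep / 2 by lra.
have [n hn] := filter_ex (unif _ ep2).
exists (f n); split; first exact: Mf.
(* Two min-forms with the same slopes and close coefficients are close. *)
apply: EV => /= z _; apply: hE.
have [e [t [ht ->]]] := point_on_edge m z.
have [h1 [i h2]] := mf n e t ht; have [h3 [j h4]] := mfg e t ht.
apply: (@le_lt_trans _ _ (ep / 2)); last by lra.
rewrite ler_norml.
have := hn e i; have := hn e j; have := h1 j; have := h3 i.
by rewrite !ler_norml -/(al n e); move: h2 h4; rewrite -/(al n e) => /= h2 h4; lra.
Unshelve. all: by end_near.
Qed.

End Limit.

(** * Every jump is attained *)

Section Attained.
Variables (R : realType) (Gam : metricType R) (r : nat).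
Variables (S : slope_structure Gam r) (D : divisor Gam) (M : set (Gam -> R)).
Hypothesis admM : admissible_with D M S.
Local Notation m := (ss_model S).
Local Notation oE := (oedge (ss_graph S)).

(** At the point of parameter u of the edge o, the slope of f drops by at
    least one. Stated without derivatives, so that it passes to limits. *)
Definition kink (o : oE) (u : R) (f : Gam -> R) : Prop :=
  forall h, 0 <= h -> h <= u -> h <= len o.1 - u ->
    f (oept m o (u + h)) + f (oept m o (u - h)) <= 2 * f (oept m o u) - h.

Lemma kink_of_rank f o u : compatible S f -> 0 < u < len o.1 ->
  1 <= rank_of S (oept m o u) f -> kink o u f.
Proof.
move=> cf hu h1 h h0 hu1 hu2.
have [i [j [ir jr hi hj hr]]] := compatible_interior cf hu.
have sum : (ss_slopes o i)%:~R + (ss_slopes (orev o) j)%:~R <= -1 :> R.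
  have -> : -1 = (- 1%N%:Z)%:~R :> R by [].
  by rewrite -intrD ler_int; apply: ss_slopes_sum => //; lia.
have hp : f (oept m o (u + h)) <= f (oept m o u) + (ss_slopes o i)%:~R * (u + h - u).
  by apply: (compatible_half_tangent cf _ hi); lra.
have hq : f (oept m o (u - h)) <=
    f (oept m o u) + (ss_slopes (orev o) j)%:~R * (u - (u - h)).
  by apply: (compatible_half_tangent_back cf _ hj); lra.
have : ((ss_slopes o i)%:~R + (ss_slopes (orev o) j)%:~R) * h <= -1 * h :> R.
  exact: ler_wpM2r.
lra.
Qed.

(** Beyond a kink, f lies below a line of smaller slope. *)
Lemma kink_drop f o s u p t : compatible S f -> 0 <= s -> s < u -> u < len o.1 ->
  right_affine (fun t => f (oept m o t)) s p -> kink o u f ->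
  u <= t <= len o.1 ->
  f (oept m o t) <= f (oept m o s) + p * (t - s) - (t - u).
Proof.
move=> cf s0 su ul hp hk ht.
have hu : 0 < u < len o.1 by lra.
have [i [j [ir jr hi hj _]]] := compatible_interior cf hu.
set p' : R := (ss_slopes o i)%:~R in hi; set q' : R := (ss_slopes _ j)%:~R in hj.
have sum : p' + q' <= -1.
  have [e1 e10 h1] := hi; have [e2 e20 h2] := hj.
  pose h := Num.min (Num.min e1 e2) (Num.min u (len o.1 - u)).
  have h0 : 0 < h by rewrite !lt_min e10 e20; lra.
  have [hA hB hC hD] : [/\ h <= e1, h <= e2, h <= u & h <= len o.1 - u].
    by split; rewrite /h !ge_min lexx ?orbT.
  have := hk h (ltW h0) hC hD.
  have := h1 h; have := h2 h; rewrite !oept_orev.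
  rewrite (_ : len o.1 - (len o.1 - u + h) = u - h); last by lra.
  rewrite subKr (ltW h0) hA hB => -> // -> // H.
  have : (p' + q') * h <= -1 * h by lra.
  by rewrite ler_pM2r.
have A1 : f (oept m o t) <= f (oept m o u) + p' * (t - u).
  by apply: (compatible_half_tangent cf _ hi ht); lra.
have A2 : f (oept m o s) <= f (oept m o u) + q' * (u - s).
  by apply: (compatible_half_tangent_back cf _ hj); lra.
have A3 : f (oept m o u) <= f (oept m o s) + p * (u - s).
  by apply: (compatible_half_tangent cf _ hp); lra.
(* f u <= f s + p * (u - s) by concavity at s, and f s <= f u + q' * (u - s) by
   concavity at u. *)
have A4 : 0 <= p + q'.
  have : 0 <= (p + q') * (u - s) by lra.
  by rewrite pmulr_lge0 //; lra.
have : p' * (t - u) <= (p - 1) * (t - u) by rewrite ler_wpM2r //; lra.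
lra.
Qed.

Lemma slope_shift (f : Gam -> R) (c : R) (x : Gam) (nu : tangent x) :
  slope nu (fun z => f z + c) = slope nu f.
Proof.
rewrite /slope; congr xget; apply/seteqP; split=> k /= [d hd [ep ep0 h]];
  exists d => //; exists ep => // t /h; first by lra.
by move=> ->; lra.
Qed.

Lemma slope_index_shift (f : Gam -> R) (c : R) (x : Gam) :
  slope_index S x (fun z => f z + c) = slope_index S x f.
Proof. by apply/funext => nu; rewrite /slope_index slope_shift. Qed.

(** A difference of at least c between slopes of elements of S^nu gives, for
    c = 0 or 1, a difference of at least c between their indices. *)
Lemma slope_index_le (f g : Gam -> R) x (nu : tangent x) (c : nat) :
  compatible S f -> compatible S g -> slope nu f <= slope nu g - c%:Z ->
  (c <= 1)%N -> (slope_index S x f nu + c <= slope_index S x g nu)%N.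
Proof.
move=> cf cg h c1.
have [[fr _ _] fE] := slope_indexP x cf; have [[gr _ _] gE] := slope_indexP x cg.
have le_fg : (slope_index S x f nu <= slope_index S x g nu)%N.
  by rewrite -(slope_val_le S nu) // -fE -gE; lia.
have [c0|cn0] := eqVneq c 0%N; first by rewrite c0 addn0.
rewrite (_ : c = 1%N) ?addn1 ?ltn_neqAle ?le_fg ?andbT; last by lia.
by apply/eqP => E; have := fE nu; rewrite E -gE; lia.
Qed.

Section Sequence.
Variables (U : set_system nat) (x : Gam) (f : nat -> Gam -> R) (g : Gam -> R).
Hypothesis UU : UltraFilter U.
Hypothesis Mf : forall n, M (f n).
Hypothesis Mg : M g.
Hypothesis fg : forall z ep, 0 < ep -> U [set n | `|f n z - g z| <= ep].

Let FU : Filter U. Proof. exact: filter_filter. Qed.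

Lemma kink_limit o u : (forall n, kink o u (f n)) -> kink o u g.
Proof.
move=> hk h h0 h1 h2; apply/ler_addgt0Pr => ep ep0.
have ep4 : 0 < ep / 4 by lra.
have [n [[/= A B] C]] := filter_ex (filterI (filterI (fg (oept m o (u + h)) ep4)
  (fg (oept m o (u - h)) ep4)) (fg (oept m o u) ep4)).
by move: A B C (hk n h h0 h1 h2); rewrite !ler_norml; lra.
Qed.

(** If, at the points of o near x, f n lies below the line of slope
    [slope nu (f n) - c] through its value at x, up to a small error, then these
    numbers bound the slope of the limit. *)
Lemma slope_limit (nu : tangent x) o s (c : int) :
  0 <= s < len o.1 -> x = oept m o s -> parallel m nu o ->
  (forall t, 0 < t -> t <= len o.1 - s -> U [set n |
     f n (oept m o (s + t)) <= f n x + ((slope nu (f n))%:~R - c%:~R) * t + t / 4]) ->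
  U [set n | slope nu g <= slope nu (f n) - c].
Proof.
move=> hs xE hp hU.
have [nu' hp' [e e0 he]] := tangent_at (admissible_compatible admM Mg) hs xE.
rewrite (parallel_inj hp' hp) in he.
pose t := Num.min e (len o.1 - s).
have t0 : 0 < t by rewrite lt_min e0; lra.
have te : t <= e by rewrite ge_min lexx.
have tl : t <= len o.1 - s by rewrite ge_min lexx orbT.
have t8 : 0 < t / 8 by lra.
have UF := @filterI _ U FU _ _ (@filterI _ U FU _ _ (hU t t0 tl) (fg x t8))
  (fg (oept m o (s + t)) t8).
apply: (@filterS _ U FU _ _ _ UF) => n /= [[A B] C].
have := he t; rewrite (ltW t0) te -xE => /(_ isT) E.
move: B C; rewrite !ler_norml E => B C.
have : (slope nu g)%:~R * t <= ((slope nu (f n))%:~R - c%:~R + 1 / 2) * t :> R by lra.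
rewrite ler_pM2r // => H.
rewrite -ltzD1 -(ltr_int R) !intrD rmorphN /=; lra.
Qed.

Lemma slope_limit_le (nu : tangent x) : U [set n | slope nu g <= slope nu (f n)].
Proof.
have [ o hp] := parallel_exists m nu; have [s [hs xE _]] := parallel_start hp.
have := @slope_limit nu o s 0 hs xE hp; rewrite (_ : [set n | _ <= _ - 0] =
  [set n | slope nu g <= slope nu (f n)]); last first.
  by apply/seteqP; split=> n /=; rewrite subr0.
apply=> t t0 tl; apply: filterE => n /=.
have [nu' hp' h] := tangent_at (admissible_compatible admM (Mf n)) hs xE.
rewrite (parallel_inj hp' hp) in h.
have : f n (oept m o (s + t)) <= f n (oept m o s) + (slope nu (f n))%:~R * (s + t - s).
  by apply: (compatible_half_tangent (admissible_compatible admM (Mf n)) hs h); lra.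
by rewrite -xE; lra.
Qed.

(** When kinks in direction nu converge to x, the slope of the limit along nu
    is smaller by at least one. *)
Lemma slope_limit_lt (nu : tangent x) o s (u : nat -> R) :
  0 <= s < len o.1 -> x = oept m o s -> parallel m nu o ->
  (forall n, s < u n < len o.1) ->
  (forall ep, 0 < ep -> U [set n | u n - s <= ep]) ->
  (forall n, kink o (u n) (f n)) ->
  U [set n | slope nu g <= slope nu (f n) - 1].
Proof.
move=> hs xE hp hu us hk; apply: (slope_limit hs xE hp) => t t0 tl.
have t4 : 0 < t / 4 by lra.
apply: (@filterS _ U FU _ _ _ (us _ t4)) => n /= hn.
have [nu' hp' h] := tangent_at (admissible_compatible admM (Mf n)) hs xE.
rewrite (parallel_inj hp' hp) in h.
have /andP[hu1 hu2] := hu n; have /andP[s0 _] := hs.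
have : f n (oept m o (s + t)) <=
    f n (oept m o s) + (slope nu (f n))%:~R * (s + t - s) - (s + t - u n).
  apply: (kink_drop (admissible_compatible admM (Mf n)) s0 hu1 hu2 h (hk n)).
  by lra.
by rewrite -xE; lra.
Qed.

Lemma slope_index_limit : U [set n | forall nu : tangent x,
  (slope_index S x g nu <= slope_index S x (f n) nu)%N].
Proof.
have : \forall n \near U, forall o : oE, forall nu : tangent x,
    parallel m nu o -> slope nu g <= slope nu (f n).
  apply: filter_forall => o.
  have [[nu hp]|no] := pselect (exists nu : tangent x, parallel m nu o).
    apply: (@filterS _ U FU _ _ _ (slope_limit_le nu)) => n /= h nu' hp'.
    by rewrite (parallel_inj hp' hp).
  by apply: filterE => n nu hp; case: no; exists nu.
apply: filterS => n h nu; have [ o hp] := parallel_exists m nu.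
rewrite -[X in (X <= _)%N]addn0.
apply: slope_index_le => //; try exact: (admissible_compatible admM).
by have := h _ _ hp; lia.
Qed.

End Sequence.

Local Notation rho := (@ss_rank _ _ _ S _).

(** Kinks at the points of Q and rank at least r - |Q| at x force the slopes at
    x to be at least s_g. *)
Definition forces (x : Gam) (Q : seq (oE * R)) (g : tangent x -> nat) : Prop :=
  forall f, M f -> (forall q, q \in Q -> kink q.1 q.2 f) ->
    r%:Z - (size Q)%:Z <= rho (slope_index S x f) ->
    cube_le g (slope_index S x f).

(** An additional kink, in direction nu and close enough to x, forces the least
    jump above g + e_nu. Otherwise there are functions violating this with
    kinks converging to x. In the limit the kink is absorbed by x, so that the
    slope vector strictly decreases and, both being jumps, the rank at x
    increases: g is then forced for the limit. *)
Lemma forces_step x Q g (nu : tangent x) g' :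
  forces Q g -> cube_le (incr g nu) g' -> cube r g' ->
  rho g' = rho (incr g nu) ->
  exists q : oE * R, 0 < q.2 < len q.1.1 /\ forces (q :: Q) g'.
Proof.
move=> fQ gg' g'r rE; apply: contrapT => /forallNP no.
have [ o hp] := parallel_exists m nu; have [s [hs xE _]] := parallel_start hp.
pose u (n : nat) : R := s + (len o.1 - s) * n.+2%:R^-1.
have inv_lt (n : nat) : 0 < (n.+2%:R^-1 : R) < 1.
  by rewrite invr_gt0 ltr0n /= invf_lt1 ?ltr0n // ltr1n.
have hu n : s < u n < len o.1.
  have /andP[i0 i1] := inv_lt n; have ls : 0 < len o.1 - s by lra.
  have h1 : 0 < (len o.1 - s) * n.+2%:R^-1 by exact: mulr_gt0.
  have h2 : (len o.1 - s) * n.+2%:R^-1 < (len o.1 - s) * 1 by rewrite ltr_pM2l.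
  rewrite mulr1 in h2; rewrite /u.
  by move: h1 h2; set w := _ * _; move=> h1 h2; lra.
have ex n : exists f, [/\ M f, forall q, q \in Q -> kink q.1 q.2 f,
    kink o (u n) f, r%:Z - (size Q).+1%:Z <= rho (slope_index S x f)
    & ~ cube_le g' (slope_index S x f) /\ f x = 0].
  have un : 0 < (o, u n).2 < len (o, u n).1.1 by have := hu n; rewrite /=; lra.
  apply: contrapT => nf; apply: (no (o, u n)); split=> // f Mf kf rf.
  apply: contrapT => ng; apply: nf; exists (fun z => f z + - f x).
  have ksh o1 u1 : kink o1 u1 f -> kink o1 u1 (fun z => f z + - f x).
    by move=> k h h0 h1 h2; have := k h h0 h1 h2; lra.
  split; rewrite ?slope_index_shift ?subrr //.
  - by case: admM => -[_ _ h] _ _ _ _; exact: h.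
  - by move=> q qQ; apply: ksh; apply: kf; rewrite inE qQ orbT.
  - by apply: ksh; apply: (kf (o, u n)); rewrite inE eqxx.
have [f hf] := choice ex.
have Mf n : M (f n) by case: (hf n).
have [U [UU Uoo]] := ultraFilterLemma (@eventually_filter).
have fx0 n : f n x = 0 by case: (hf n) => _ _ _ _ [].
have [h Mh fh] := admissible_compact admM UU Mf fx0.
have us ep : 0 < ep -> U [set n | u n - s <= ep].
  move=> ep0; apply: Uoo; have ls : 0 < len o.1 - s by lra.
  have [N _ /= hN] : \forall n \near \oo, n.+1%:R^-1 < ep / (len o.1 - s) :> R.
    exact: near_infty_natSinv_lt (PosNum (divr_gt0 ep0 ls)).
  exists N => // n /= /leqW /hN.
  by rewrite ltr_pdivlMr // /u addrAC subrr add0r mulrC => /ltW.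
have kn n : kink o (u n) (f n) by case: (hf n).
have cf n := admissible_compatible admM (Mf n).
have ch := admissible_compatible admM Mh.
(* The slope index of the limit h is below that of f n, strictly at nu. *)
have [n [/= lt_nu le_all]] := filter_ex (filterI
  (slope_limit_lt UU Mf Mh fh hs xE hp hu us kn)
  (slope_index_limit x UU Mf Mh fh)).
have [_ _ _ rn [ngn _]] := hf n.
have [jh _] := slope_indexP x ch; have [jn _] := slope_indexP x (cf n).
have lt1 := slope_index_le ch (cf n) lt_nu isT; rewrite addn1 in lt1.
have [nr _ _] := jn.
have rkP := ss_rankP S x.
have rk := jump_lt_rank rkP jh nr le_all (ex_intro _ nu lt1).
have le_g : cube_le g (slope_index S x h).
  apply: fQ => //; last by lia.
  by move=> q qQ; apply: (kink_limit UU fh) => k; case: (hf k) => _ hk _ _ _; exact: hk.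
apply: ngn; apply: (jump_ge_closure rkP g'r gg' rE jn).
apply: incr_le; first exact: cube_le_trans le_all.
by apply: leq_ltn_trans lt1; exact: le_g.
Qed.

(** Climbing from 0 to a jump by taking, at each step, the least jump above a
    unit step produces r - rho a kinks that force the jump. *)
Lemma exists_forcing x (a : tangent x -> nat) : jump r rho a ->
  exists2 Q, (forall q, q \in Q -> 0 < q.2 < len q.1.1) &
    rho a = r%:Z - (size Q)%:Z /\ forces Q a.
Proof.
move=> ja; have [ar a0 _] := ja; have rkP := ss_rankP S x.
have finx := finite_tangent m x.
suff climb (k : nat) : forall g Q, jump r rho g -> cube_le g a ->
    rho g = r%:Z - (size Q)%:Z -> (forall q, q \in Q -> 0 < q.2 < len q.1.1) ->
    forces Q g -> rho g = rho a + k%:Z ->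
    exists2 Q, (forall q, q \in Q -> 0 < q.2 < len q.1.1) &
      rho a = r%:Z - (size Q)%:Z /\ forces Q a.
  have inx := inhabited_tangent m x.
  have r0 := rank0 rkP inx.
  have ra : rho a <= r%:Z.
    by rewrite -r0; apply: (rank_anti rkP ar).
  apply: (climb `|r%:Z - rho a|%N _ [::] (jump0 rkP inx)) => //.
  - by rewrite r0 subr0.
  - by rewrite r0; lia.
elim: k => [|k IHk] g Q jg ga gE Qin fQ gk.
  have [E|ex] := cube_le_antisym_ex ga; first by exists Q => //; rewrite -E.
  by have := jump_lt_rank rkP jg ar ga ex; lia.
have [gr g0 gj] := jg.
have [nu gnu] : exists nu, (g nu < a nu)%N.
  by have [E|//] := cube_le_antisym_ex ga; move: gk; rewrite E; lia.
have ia := incr_le ga gnu; have ir := cube_le_cube ia ar.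
have iE : rho (incr g nu) = rho g - 1 by exact: gj.
have [|g' [jg' ig' g'E]] := exists_closure rkP finx ir; first by lia.
have [g'r _ _] := jg'.
have [q [hq fq]] := forces_step fQ ig' g'r g'E.
apply: (IHk g' (q :: Q)) => //.
- exact: (jump_ge_closure rkP g'r ig' g'E ja ia).
- by rewrite g'E iE gE /=; lia.
- by move=> p; rewrite inE => /orP[/eqP ->//|]; exact: Qin.
- by rewrite g'E iE gk; lia.
Qed.

Lemma coeff_sum_points (Q : seq Gam) (z : Gam) :
  coeff z (\sum_(y <- Q) << y >> : divisor Gam) = (count_mem z Q)%:Z.
Proof.
elim: Q => [|y Q IH]; first by rewrite big_nil coeff0.
by rewrite big_cons coeffD IH coeffU mul1r PoszD /=; case: eqP.
Qed.

Lemma deg_sum_points (Q : seq Gam) :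
  deg (\sum_(y <- Q) << y >> : divisor Gam) = (size Q)%:Z.
Proof.
elim: Q => [|y Q IH]; first by rewrite big_nil deg0.
by rewrite big_cons degD IH degU /=; lia.
Qed.

(** Every jump is the slope index of an element of M. *)
Lemma jump_attained x (a : tangent x -> nat) : jump r rho a ->
  exists2 f, M f & slope_index S x f = a.
Proof.
move=> ja; have [ar a0 _] := ja; have rkP := ss_rankP S x.
have [Q Qin [aE fQ]] := exists_forcing ja.
pose pts := [seq oept m q.1 q.2 | q <- Q].
(* At each point of Q the element f of M given for E has a kink. *)
pose E : divisor Gam := << rho a *g x >> + \sum_(y <- pts) << y >>.
have cE z : coeff z E = rho a * (x == z)%:R + (count_mem z pts)%:Z.
  by rewrite /E coeffD coeffU coeff_sum_points.
have effE : effective E by move=> z; rewrite cE addr_ge0 // mulr_ge0.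
have degE : deg E = r%:Z by rewrite /E degD degU deg_sum_points size_map aE subrK.
have [_ _ _ _ /(_ E effE degE) [f [Mf rf _]]] := admM.
have cf := admissible_compatible admM Mf.
have ra : rho a <= rho (slope_index S x f).
  by have := rf x; rewrite cE eqxx mulr1 rank_ofE; lia.
have le_a : cube_le a (slope_index S x f).
  apply: fQ => //; last by rewrite -aE.
  move=> q qQ; apply: kink_of_rank => //; first exact: Qin.
  apply: le_trans (rf _); rewrite cE.
  rewrite -[1]add0r; apply: lerD; first by rewrite mulr_ge0.
  by rewrite lez_nat -has_count has_pred1; apply: map_f.
exists f => //; have [E'|ex] := cube_le_antisym_ex le_a; first by [].
have [[fr _ _] _] := slope_indexP x cf.
by have := jump_lt_rank rkP ja fr le_a ex; lia.
Qed.

(** The slopes of the elements of M in direction nu are exactly S^nu. *)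
Lemma slope_set_attained x (nu : tangent x) :
  slope_set S nu = [set slope nu f | f in M].
Proof.
apply/seteqP; split=> k /=; last first.
  by move=> [f Mf <-]; have [_ /(_ x) [h _]] := admissible_compatible admM Mf; exact: h.
move=> [i /= ir <-]; have rkP := ss_rankP S x.
have ax := rank_axis rkP nu ir.
have cr := cube_axis nu ir.
have [|c [jc ic cE]] := exists_closure rkP (finite_tangent m x) cr.
  by rewrite ax; lia.
have [cr' _ _] := jc.
have cnu : c nu = i.
  have := ic nu; have := rank_coord rkP nu cr'; rewrite cE ax.
  by rewrite /unit_vec eqxx muln1; lia.
have [f Mf fE] := jump_attained jc.
exists f => //; have [_ ->] := slope_indexP x (admissible_compatible admM Mf).
by rewrite fE cnu.
Qed.

(** The jumps at x are the points whose slope vector is realized by M. *)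
Lemma jump_iff_attained x (a : tangent x -> nat) : cube r a ->
  jump r rho a <->
  exists2 f, M f & forall nu, slope nu f = slope_val S nu (a nu).
Proof.
move=> ar; split=> [/jump_attained [f Mf <-]|[f Mf fE]].
  exists f => //.
  by have [_ h] := slope_indexP x (admissible_compatible admM Mf).
rewrite -(slope_index_eq ar fE).
by have [h _] := slope_indexP x (admissible_compatible admM Mf).
Qed.

End Attained.

(** * Uniqueness of the slope structure *)

(** Two increasing enumerations of the same set of integers coincide. *)
Lemma increasing_image_eq (r r' : nat) (s s' : nat -> int) :
  (forall i j, (i < j <= r)%N -> s i < s j) ->
  (forall i j, (i < j <= r')%N -> s' i < s' j) ->
  [set s i | i in [set i | (i <= r)%N]] = [set s' i | i in [set i | (i <= r')%N]] ->
  r = r' /\ forall i, (i <= r)%N -> s i = s' i.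
Proof.
move=> inc inc' E.
have sorted_mk (n : nat) (t : nat -> int) :
    (forall i j, (i < j <= n)%N -> t i < t j) -> sorted <%O (mkseq t n.+1).
  move=> h; apply: (homo_sorted_in (P := [pred i | (i <= n)%N]) (e := ltn)).
  - by move=> i j /= _ jn ij; apply: h; rewrite ij.
  - by apply/allP => i; rewrite mem_iota /= add0n ltnS.
  - exact: iota_ltn_sorted.
have mem_mk (n : nat) (t : nat -> int) k :
    k \in mkseq t n.+1 <-> [set t i | i in [set i | (i <= n)%N]] k.
  split=> [/mapP[i]|[i /= hi <-]].
    by rewrite mem_iota /= add0n ltnS => hi ->; exists i.
  by apply/mapP; exists i => //; rewrite mem_iota /= add0n ltnS.
have mkE : mkseq s r.+1 = mkseq s' r'.+1.
  apply: lt_sorted_eq; [exact: sorted_mk|exact: sorted_mk|].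
  by move=> k; apply/idP/idP; rewrite !mem_mk E.
have rE : r = r' by apply: succn_inj; rewrite -(size_mkseq s r.+1) mkE size_mkseq.
split=> // i ir.
by rewrite -[LHS](nth_mkseq 0 s (_ : i < r.+1)%N) // mkE nth_mkseq // -rE.
Qed.

Unset Implicit Arguments.

Theorem corollary1p3 (R : realType) (Gam : metricType R)
    (hGam : metric_graph Gam) (D : divisor Gam) (M : set (Gam -> R))
    (hM : admissible D M) (r r' : nat)
    (S : slope_structure Gam r) (S' : slope_structure Gam r')
    (hS : admissible_with D M S) (hS' : admissible_with D M S') :
  slope_structure_eq S S'.
Proof.
have setE x (nu : tangent x) : slope_set S nu = slope_set S' nu.
  by rewrite (slope_set_attained hS) (slope_set_attained hS').
have slopesE x (nu : tangent x) := increasing_image_eq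
  (@slope_val_lt _ _ _ S x nu) (@slope_val_lt _ _ _ S' x nu) (setE x nu).
have [G [mG]] := hGam.
have [e _] := exists_edge G.
have [nu0] := inhabited_tangent mG (ept mG e 0).
have [rE _] := slopesE _ nu0.
split=> // x.
move: S' hS' setE slopesE; rewrite -rE => T hT setE slopesE.
apply: rank_determined_by_jumps; first exact: finite_tangent mG x.
- exact: inhabited_tangent mG x.
- exact: ss_rankP.
- exact: ss_rankP.
- move=> a; split=> ja; have [ar _ _] := ja.
    apply/(jump_iff_attained hT ar).
    have /(jump_iff_attained hS ar) [f Mf fE] := ja.
    by exists f => // nu; rewrite fE; have [_ ->] := slopesE x nu.
  apply/(jump_iff_attained hS ar).
  have /(jump_iff_attained hT ar) [f Mf fE] := ja.
  by exists f => // nu; rewrite fE; have [_ ->] := slopesE x nu.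
Qed.
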